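(* Let $(R, \mathfrak{m})$ be a Noetherian local ring of dimension $d \ge 1$. Then: \begin{enumerate} \item[(1)] $\mathfrak{a}(R) \subseteq \mathfrak{c}(R)$ if $d = 1$, and $\mathfrak{a}(R)^{2^{d-2}} \subseteq \mathfrak{c}(R)$ if $d \ge 2$. \item[(2)] $\mathfrak{a}(R)^{2^{d-1}} \subseteq \mathfrak{d}(R)$. \end{enumerate}
   Context: For $0 \le i \le d$ let $\mathfrak{a}_i(R) = \mathrm{Ann}(H^i_{\mathfrak{m}}(R))$, where $H^i_{\mathfrak m}$ denotes local cohomology with support in $\mathfrak m$, and let $\mathfrak{a}(R) = \prod_{i=0}^{d-1} \mathfrak{a}_i(R)$. For a system of parameters $\underline{x} = x_1, \ldots, x_d$ of $R$ and $0 \le s \le d$, set $Q_s = (x_1, \ldots, x_s)$, with $Q_0 = (0)$. For $1 \le s \le d$ and $n \ge 1$ set $$\Lambda_{s,n} = \{(\alpha_1, \ldots, \alpha_s) \in \mathbb{N}^s \mid \alpha_i \ge 1 \text{ for all } 1 \le i \le s,\ \sum_{i=1}^s \alpha_i = s+n-1\},$$ and for $\alpha \in \Lambda_{s,n}$ set $Q_s(\alpha) = (x_1^{\alpha_1}, \ldots, x_s^{\alpha_s})$. One has $Q_s^n \subseteq \bigcap_{\alpha \in \Lambda_{s,n}} Q_s(\alpha)$. Define $$\mathfrak{c}(R) = \bigcap_{\underline{x},\ 0 \le s < d,\ n \ge 1} \mathrm{Ann}\Big(\frac{Q_s^n : x_{s+1}}{Q_s^n}\Big), \qquad \mathfrak{d}(R)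 = \bigcap_{\underline{x},\ 1 \le s \le d,\ n \ge 1} \mathrm{Ann}\Big(\frac{\bigcap_{\alpha \in \Lambda_{s,n}} Q_s(\alpha)}{Q_s^n}\Big),$$ where $\underline{x}$ runs over all systems of parameters of $R$. *)

(* Defs.v *)
From HB Require Import structures.
From mathcomp Require Import all_boot all_order all_algebra.
From mathcomp Require Import all_classical.

Set Implicit Arguments.
Unset Strict Implicit.
Unset Printing Implicit Defensive.

Import GRing.Theory.
Local Open Scope classical_set_scope.
Local Open Scope ring_scope.

Definition is_ideal (R : comNzRingType) (I : set R) : Prop :=
  [/\ I 0,
      forall x y, I x -> I y -> I (x + y)
    & forall a x, I x -> I (a * x)].

Definition ideal_gen (R : comNzRingType) (S : set R) : set R :=
  smallest (@is_ideal R) S.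

Definition ideal_mul (R : comNzRingType) (I J : set R) : set R :=
  ideal_gen [set a * b | a in I & b in J].

Definition ideal_pow (R : comNzRingType) (I : set R) (n : nat) : set R :=
  iter n (ideal_mul I) [set: R].

Definition ideal_prod (R : comNzRingType) (n : nat) (I : nat -> set R) :
    set R :=
  \big[@ideal_mul R/[set: R]]_(i < n) I i.

Definition colon (R : comNzRingType) (I : set R) (x : R) : set R :=
  [set r | I (r * x)].

Definition radical (R : comNzRingType) (I : set R) : set R :=
  [set r | exists n, I (r ^+ n)].

Definition prime_ideal (R : comNzRingType) (P : set R) : Prop :=
  [/\ is_ideal P,
      ~ P 1
    & forall a b, P (a * b) -> P a \/ P b].

Definition maximal_ideal (R : comNzRingType) (M : set R) : Prop :=
  [/\ is_ideal M,
      ~ M 1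
    & forall J, is_ideal J -> ~ J 1 -> M `<=` J -> J = M].

Definition noetherian (R : comNzRingType) : Prop :=
  forall I : set R, is_ideal I -> exists s : seq R, I = ideal_gen [set` s].

Definition local_ring (R : comNzRingType) (m : set R) : Prop :=
  maximal_ideal m /\ forall M, maximal_ideal M -> M = m.

(* P 0 < P 1 < ... < P n, a chain of n + 1 primes; P i is irrelevant for
   i > n. *)
Definition prime_chain (R : comNzRingType) (n : nat) (P : nat -> set R) :
    Prop :=
  (forall i, (i <= n)%N -> prime_ideal (P i)) /\
  (forall i, (i < n)%N -> P i `<` P i.+1).

Definition krull_dim (R : comNzRingType) (d : nat) : Prop :=
  (exists P : nat -> set R, prime_chain d P) /\
  (forall n (P : nat -> set R), prime_chain n P -> (n <= d)%N).

(* The annihilator of A / B, for submodules B `<=` A of M. *)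
Definition ann_quot (R : comNzRingType) (M : lmodType R) (A B : set M) :
    set R :=
  [set r | forall z, A z -> B (r *: z)].

(* The same for ideals B `<=` A, regarded as submodules of R. *)
Definition ann_ideal_quot (R : comNzRingType) (A B : set R) : set R :=
  @ann_quot R R^o A B.

(* The section functor: elements killed by a power of m. *)
Definition torsion (R : comNzRingType) (m : set R) (M : lmodType R) : set M :=
  [set z | exists n, forall r, ideal_pow m n r -> r *: z = 0].
Arguments torsion [R] m M _.

Definition injective_module (R : comNzRingType) (E : lmodType R) : Prop :=
  forall (M N : lmodType R) (f : {linear M -> N}) (g : {linear M -> E}),
    injective f -> exists h : {linear N -> E}, forall u, h (f u) = g u.

Record inj_resolution (R : comNzRingType) (M : lmodType R) := InjResolution {
  res_obj : nat -> lmodType R;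
  res_aug : {linear M -> res_obj 0};
  res_d : forall i, {linear res_obj i -> res_obj i.+1};
  res_injective : forall i, injective_module (res_obj i);
  res_aug_inj : injective res_aug;
  res_exact0 : forall z, res_d 0 z = 0 <-> exists y, res_aug y = z;
  res_exactS : forall i z, res_d i.+1 z = 0 <-> exists y, res_d i y = z
}.

(* H^i_m(M) is the i-th cohomology lc_cocycle m I i / lc_coboundary m I i of
   the complex of m-torsion sections of an injective resolution I of M. *)
Definition lc_cocycle (R : comNzRingType) (m : set R) (M : lmodType R)
    (I : inj_resolution M) (i : nat) : set (res_obj I i) :=
  [set z | torsion m (res_obj I i) z /\ res_d I i z = 0].

Arguments lc_cocycle [R] m [M] I i _.

Definition lc_coboundary (R : comNzRingType) (m : set R) (M : lmodType R)
    (I : inj_resolution M) (i : nat) : set (res_obj I i) :=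
  match i return set (res_obj I i) with
  | 0 => [set 0]
  | j.+1 => [set res_d I j y | y in torsion m (res_obj I j)]
  end.

Arguments lc_coboundary [R] m [M] I i _.

(* Ann H^i_m(M). Any two injective resolutions of M give isomorphic cohomology
   modules, so the annihilator may be tested on any one of them. *)
Definition ann_lc (R : comNzRingType) (m : set R) (M : lmodType R) (i : nat) :
    set R :=
  [set r | exists I : inj_resolution M,
     ann_quot (lc_cocycle m I i) (lc_coboundary m I i) r].

Definition ideal_a (R : comNzRingType) (m : set R) (d : nat) : set R :=
  ideal_prod d (ann_lc m R^o).

(* d elements generating an m-primary ideal, where d is meant to be the
   dimension of R. The sequence is indexed from 0: x_1, ..., x_d are
   x 0, ..., x (d - 1). *)
Definition sop (R : comNzRingType) (m : set R) (d : nat) (x : 'I_d -> R) :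
    Prop :=
  radical (ideal_gen (range x)) = m.

Definition Qs (R : comNzRingType) (d : nat) (x : 'I_d -> R) (s : nat) : set R :=
  ideal_gen [set x i | i in [set i : 'I_d | (i < s)%N]].

Definition Lambda (s n : nat) : set ('I_s -> nat) :=
  [set alpha | (forall i, (1 <= alpha i)%N) /\
               (\sum_(i < s) alpha i = s + n - 1)%N].

Arguments Lambda s n _ : clear implicits.

Definition Qs_pow (R : comNzRingType) (d : nat) (x : 'I_d -> R)
    (s : nat) (hs : (s <= d)%N) (alpha : 'I_s -> nat) : set R :=
  ideal_gen (range (fun i : 'I_s => x (widen_ord hs i) ^+ alpha i)).

(* The index s : 'I_d runs over 0 <= s < d, and x s is x_{s+1} in the
   numbering from 1. *)
Definition ideal_c (R : comNzRingType) (m : set R) (d : nat) : set R :=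
  [set r | forall x : 'I_d -> R, sop m x ->
     forall (s : 'I_d) (n : nat), (1 <= n)%N ->
     ann_ideal_quot (colon (ideal_pow (Qs x s) n) (x s))
                    (ideal_pow (Qs x s) n) r].

Definition ideal_d (R : comNzRingType) (m : set R) (d : nat) : set R :=
  [set r | forall x : 'I_d -> R, sop m x ->
     forall (s : nat) (hs : (s <= d)%N) (n : nat), (1 <= s)%N -> (1 <= n)%N ->
     ann_ideal_quot (\bigcap_(alpha in Lambda s n) Qs_pow x hs alpha)
                    (ideal_pow (Qs x s) n) r].

(* Main.v *)
(** Write [a] for [ideal_a m d]. If [K] is the Koszul complex of a system of
    parameters and [I] an injective resolution of [R], the part of
    [Hom (K, I)] modulo [m]-torsion is exact; zigzagging through the double
    complex of torsion sections shows that [a] kills the cohomology of [K] in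
    degree [d - 1], hence [(Q_s : x_(s+1)) / Q_s] for every system of parameters
    (the parameters after [x_(s+1)] are raised to the power [t] and removed by
    Krull's intersection theorem).

    For powers, let [k_s] be such that [a ^ k_s] kills the quotient of the
    intersection of the [Q_s(alpha)] by [Q_s ^ n], for all [n] and modulo further
    parameters. As [Q_s ^ n : x_(s+1)] is contained in all [Q_s(alpha) : x_(s+1)],
    the colon quotient is killed by [a ^ (k_s + 1)]. Expanding along powers of
    [x_(s+1)] gives [k_(s+1) = k_s + (k_s + 1)]; with [k_1 = 0] this is
    [k_s = 2 ^ (s - 1) - 1]. *)

Require Import Defs.
From HB Require Import structures.
From mathcomp Require Import all_boot all_order all_algebra.
From mathcomp Require Import all_classical.
From mathcomp Require Import zify ring.

Set Implicit Arguments.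
Unset Strict Implicit.
Unset Printing Implicit Defensive.

Import GRing.Theory.
Local Open Scope classical_set_scope.

(** * Generation, products, powers, colons and sums of ideals *)

Section Ideals.
Local Open Scope ring_scope.
Variable R : comNzRingType.
Implicit Types (I J K : set R) (S : set R).

Lemma mem_ideal0 I : is_ideal I -> I 0. Proof. by case. Qed.
Lemma mem_idealD I x y : is_ideal I -> I x -> I y -> I (x + y).
Proof. by case=> _ + _; apply. Qed.
Lemma mem_idealMl I a x : is_ideal I -> I x -> I (a * x).
Proof. by case=> _ _; apply. Qed.
Lemma mem_idealMr I a x : is_ideal I -> I x -> I (x * a).
Proof. by rewrite mulrC; exact: mem_idealMl. Qed.
Lemma mem_idealN I x : is_ideal I -> I x -> I (- x).
Proof. by move=> hI Ix; rewrite -mulN1r; exact: mem_idealMl. Qed.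
Lemma mem_idealB I x y : is_ideal I -> I x -> I y -> I (x - y).
Proof. by move=> hI Ix Iy; apply: mem_idealD => //; exact: mem_idealN. Qed.

Lemma is_ideal_gen S : is_ideal (ideal_gen S).
Proof.
split=> [I [hI _]|x y Ix Iy I hI|a x Ix I hI]; first exact: mem_ideal0.
- by apply: mem_idealD hI.1 _ _; [exact: Ix | exact: Iy].
- by apply: mem_idealMl hI.1 _; exact: Ix.
Qed.
Hint Resolve is_ideal_gen : core.

Lemma sub_ideal_gen S : S `<=` ideal_gen S.
Proof. by move=> x Sx I [_]; apply. Qed.

Lemma ideal_gen_sub S I : is_ideal I -> S `<=` I -> ideal_gen S `<=` I.
Proof. by move=> hI SI x; apply; split. Qed.

Lemma ideal_gen_mono S1 S2 : S1 `<=` S2 -> ideal_gen S1 `<=` ideal_gen S2.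
Proof.
move=> S12; apply: ideal_gen_sub => // x /S12; exact: sub_ideal_gen.
Qed.

Lemma is_idealT : is_ideal [set: R]. Proof. by []. Qed.

Lemma is_ideal_mul I J : is_ideal (ideal_mul I J).
Proof. exact: is_ideal_gen. Qed.

Lemma mem_ideal_mul I J a b : I a -> J b -> ideal_mul I J (a * b).
Proof. by move=> Ia Jb; apply: sub_ideal_gen; exists a => //; exists b. Qed.

Lemma ideal_mul_sub I J K : is_ideal K ->
  (forall a b, I a -> J b -> K (a * b)) -> ideal_mul I J `<=` K.
Proof.
by move=> hK h; apply: ideal_gen_sub => // _ [a Ia [b Jb <-]]; exact: h.
Qed.

Lemma is_ideal_pow I n : is_ideal (ideal_pow I n).
Proof. by case: n => [|n]; [exact: is_idealT | exact: is_ideal_mul]. Qed.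

Lemma mem_ideal_powS I n a b : I a -> ideal_pow I n b -> ideal_pow I n.+1 (a * b).
Proof. exact: mem_ideal_mul. Qed.

Lemma ideal_powS_sub I n K : is_ideal K ->
  (forall a b, I a -> ideal_pow I n b -> K (a * b)) -> ideal_pow I n.+1 `<=` K.
Proof. exact: ideal_mul_sub. Qed.

Lemma is_ideal_colon I x : is_ideal I -> is_ideal (colon I x).
Proof.
move=> hI; split; rewrite /colon /=.
- by rewrite mul0r; exact: mem_ideal0.
- by move=> a b Ia Ib; rewrite mulrDl; exact: mem_idealD.
- by move=> a b Ib; rewrite -mulrA; exact: mem_idealMl.
Qed.

(** Induction on [k] for all [K] at once: a factor from [I] is absorbed by passing from [K] to a
    colon ideal, which avoids explicit sums of products. *)
Lemma ideal_powD_sub I k l K : is_ideal K ->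
  (forall a b, ideal_pow I k a -> ideal_pow I l b -> K (a * b)) ->
  ideal_pow I (k + l) `<=` K.
Proof.
elim: k K => [|k IHk] K hK h.
  by move=> b Ib; rewrite -[b]mul1r; exact: h.
apply: ideal_powS_sub => // a c Ia; rewrite mulrC.
move: c; apply: IHk; first exact: is_ideal_colon.
by move=> b c Ib Ic; rewrite /colon /= mulrC mulrA; apply: h => //; exact: mem_ideal_powS.
Qed.

Lemma ideal_powD_sub1 I k K : is_ideal K -> is_ideal I ->
  (forall a b, ideal_pow I k a -> I b -> K (a * b)) ->
  ideal_pow I k.+1 `<=` K.
Proof.
by move=> hK hI h; apply: ideal_powS_sub => // a b Ia Ib; rewrite mulrC; exact: h.
Qed.

Lemma ideal_pow_le I k l : (k <= l)%N -> ideal_pow I l `<=` ideal_pow I k.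
Proof.
move=> /subnK <-; apply: ideal_powD_sub; first exact: is_ideal_pow.
by move=> a b _; apply: mem_idealMl; exact: is_ideal_pow.
Qed.

Lemma ideal_pow1 I : is_ideal I -> ideal_pow I 1 = I.
Proof.
move=> hI; apply/seteqP; split.
  by apply: ideal_powS_sub => // a b Ia _; exact: mem_idealMr.
by move=> a Ia; rewrite -[a]mulr1; exact: mem_ideal_powS.
Qed.

Lemma mem_ideal_powM I k l a b : ideal_pow I k a -> ideal_pow I l b ->
  ideal_pow I (k + l) (a * b).
Proof.
move=> + Ib; elim: k a => [|k IHk] a Ia.
  by apply: mem_idealMl => //; exact: is_ideal_pow.
apply: (ideal_powS_sub (is_ideal_colon b (is_ideal_pow I (k.+1 + l))) _ Ia).
by move=> a' b' Ia' Ib'; rewrite /colon /= -mulrA; apply: mem_ideal_powS => //; exact: IHk.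
Qed.

Lemma mem_ideal_powX I n x : I x -> ideal_pow I n (x ^+ n).
Proof. by move=> Ix; elim: n => // n IHn; rewrite exprS; exact: mem_ideal_powS. Qed.

Lemma ideal_pow_mono I J n : I `<=` J -> ideal_pow I n `<=` ideal_pow J n.
Proof.
move=> IJ; elim: n => // n IHn; apply: ideal_powS_sub; first exact: is_ideal_pow.
by move=> a b /IJ Ja /IHn; exact: mem_ideal_powS.
Qed.

Lemma ideal_pow_sub I n : is_ideal I -> (0 < n)%N -> ideal_pow I n `<=` I.
Proof. by move=> hI n0; rewrite -{2}(ideal_pow1 hI); exact: ideal_pow_le. Qed.

Definition ideal_add I J : set R := [set x | exists2 a, I a & J (x - a)].

Lemma is_ideal_add I J : is_ideal I -> is_ideal J -> is_ideal (ideal_add I J).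
Proof.
move=> hI hJ; split.
- by exists 0; [|rewrite subrr]; exact: mem_ideal0.
- move=> x y [a Ia Ja] [b Ib Jb]; exists (a + b); first exact: mem_idealD.
  by rewrite opprD addrACA; exact: mem_idealD.
- move=> c x [a Ia Ja]; exists (c * a); first exact: mem_idealMl.
  by rewrite -mulrBr; exact: mem_idealMl.
Qed.

Lemma ideal_addl I J : is_ideal J -> I `<=` ideal_add I J.
Proof. by move=> hJ a Ia; exists a => //; rewrite subrr; exact: mem_ideal0. Qed.

Lemma ideal_addr I J : is_ideal I -> J `<=` ideal_add I J.
Proof. by move=> hI b Jb; exists 0; [exact: mem_ideal0|rewrite subr0]. Qed.

Lemma ideal_add_sub I J K : is_ideal K -> I `<=` K -> J `<=` K ->
  ideal_add I J `<=` K.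
Proof.
move=> hK IK JK x [a /IK Ka /JK Kb]; rewrite -(subrK a x); exact: mem_idealD.
Qed.

Lemma ideal_genU S1 S2 :
  ideal_gen (S1 `|` S2) = ideal_add (ideal_gen S1) (ideal_gen S2).
Proof.
apply/seteqP; split.
  apply: ideal_gen_sub; first exact: is_ideal_add.
  move=> x [] Sx.
    by apply: ideal_addl => //; exact: sub_ideal_gen.
  by apply: ideal_addr => //; exact: sub_ideal_gen.
by apply: ideal_add_sub => //; apply: ideal_gen_mono => x; [left|right].
Qed.

Lemma is_ideal_set0 : is_ideal [set 0 : R].
Proof.
split=> [|x y /= -> ->|a x /= ->] //=; [exact: addr0|exact: mulr0].
Qed.

Lemma ideal_gen0 : ideal_gen (set0 : set R) = [set 0].
Proof.
apply/seteqP; split; first by apply: ideal_gen_sub => //; exact: is_ideal_set0.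
by move=> _ ->; exact: mem_ideal0.
Qed.

(* Powers of [y] are split off one at a time: [w] is congruent to
   [y ^+ (n - i) * u] modulo [I ^ i.+1 + J], and only the differences of
   successive [u]'s have to be moved into [I ^ i + J] by the factor [r]. *)
Lemma ideal_pow_telescope I J (y r w : R) n : is_ideal I -> is_ideal J ->
  (forall z k l, (0 < k)%N -> (0 < l)%N -> ideal_add (ideal_pow I k) J (z * y ^+ l) ->
     ideal_add (ideal_pow I k) J (r * z)) ->
  (0 < n)%N ->
  (forall j, (0 < j <= n)%N ->
     exists u, ideal_add (ideal_pow I (n.+1 - j)) J (w - y ^+ j * u)) ->
  ideal_add (ideal_pow (ideal_gen (I `|` [set y])) n) J (r * w).
Proof.
move=> hI hJ hr n0 hw.
set Q := ideal_gen _; set T := ideal_add (ideal_pow Q n) J.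
have hT : is_ideal T by apply: is_ideal_add => //; exact: is_ideal_pow.
have Qy : Q y by apply: sub_ideal_gen; right.
have QI : I `<=` Q by move=> a Ia; apply: sub_ideal_gen; left.
have yI i b : (i <= n)%N -> ideal_add (ideal_pow I i) J b -> T (y ^+ (n - i) * b).
  move=> le_in [a Ia Jb]; exists (y ^+ (n - i) * a); last first.
    by rewrite -mulrBr; exact: mem_idealMl.
  rewrite -{1}(subnK le_in); apply: mem_ideal_powM; first exact: mem_ideal_powX.
  exact: ideal_pow_mono Ia.
have hP i : is_ideal (ideal_add (ideal_pow I i) J).
  by apply: is_ideal_add => //; exact: is_ideal_pow.
have claim i u : (i < n)%N -> ideal_add (ideal_pow I i.+1) J (w - y ^+ (n - i) * u) ->
    T (r * (y ^+ (n - i) * u)).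
  elim: i u => [|i IHi] u lt_in hu.
    apply: ideal_addl => //; rewrite subn0; apply: mem_idealMl; first exact: is_ideal_pow.
    by apply: mem_idealMr; [exact: is_ideal_pow | exact: mem_ideal_powX].
  have [|v] := hw (n - i)%N; first lia.
  have -> : (n.+1 - (n - i) = i.+1)%N by lia.
  move=> hv; have Tv : T (r * (y ^+ (n - i) * v)) by apply: IHi => //; lia.
  (* Both approximations of [w] hold modulo [I ^ i.+1 + J]; their difference puts
     [(u - y * v) * y ^+ (n - i.+1)] there, and [r] cancels the power of [y]. *)
  have : ideal_add (ideal_pow I i.+1) J (r * (u - y * v)).
    apply: (hr _ _ (n - i.+1)%N) => //; first lia.
    have -> : (u - y * v) * y ^+ (n - i.+1) =
        (w - y ^+ (n - i) * v) - (w - y ^+ (n - i.+1) * u).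
      by rewrite (_ : n - i = (n - i.+1).+1)%N; [rewrite exprS; ring | lia].
    apply: mem_idealB => //; case: hu => a Ia Ja; exists a => //.
    exact: ideal_pow_le Ia.
  move=> /(yI _ _ (ltnW lt_in)) hd.
  have -> : r * (y ^+ (n - i.+1) * u) =
      y ^+ (n - i.+1) * (r * (u - y * v)) + r * (y ^+ (n - i) * v).
    by rewrite (_ : n - i = (n - i.+1).+1)%N; [rewrite exprS; ring | lia].
  exact: mem_idealD.
have [|u] := hw 1%N; first lia.
rewrite subSS subn0 => hu; rewrite -(subrK (y ^+ 1 * u) w) mulrDr.
apply: mem_idealD => //; last first.
  have := claim n.-1 u; rewrite prednK // (_ : n - n.-1 = 1)%N; last lia.
  by apply => //; lia.
apply: mem_idealMl => //; have := yI n _ (leqnn n) hu.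
by rewrite subnn expr0 mul1r.
Qed.

End Ideals.
#[export] Hint Resolve is_ideal_gen is_ideal_mul is_ideal_pow : core.

(** * Powers of parameter ideals *)

Section PowersOfParameters.
Local Open Scope ring_scope.
Variables (R : comNzRingType) (d : nat) (x : 'I_d -> R) (A : set R).

(** A variant of [Qs_pow] with exponents on all of ['I_d] and any index set [B], so that powers of
    further parameters can be carried through the inductions. *)
Definition gen_powers (alpha : 'I_d -> nat) (B : set 'I_d) : set R :=
  ideal_gen [set x j ^+ alpha j | j in B].

Lemma is_ideal_gen_powers alpha B : is_ideal (gen_powers alpha B).
Proof. exact: is_ideal_gen. Qed.
Hint Resolve is_ideal_gen_powers : core.

Lemma is_ideal_Qs s : is_ideal (Qs x s).
Proof. exact: is_ideal_gen. Qed.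
Hint Resolve is_ideal_Qs : core.

Hypothesis idealA : is_ideal A.
(** The input from local cohomology; [ideal_a_colon] supplies it for [ideal_a]. *)
Hypothesis A_colon : forall alpha B i l z a, (forall j, (0 < alpha j)%N) ->
  ~ B i -> (0 < l)%N -> gen_powers alpha B (z * x i ^+ l) -> A a ->
  gen_powers alpha B (a * z).

Definition below (s : nat) : set 'I_d := [set j | (j < s)%N].

Lemma is_ideal_pow_add s n alpha B :
  is_ideal (ideal_add (ideal_pow (Qs x s) n) (gen_powers alpha B)).
Proof. exact: is_ideal_add. Qed.
Hint Resolve is_ideal_pow_add : core.

Lemma gen_powers_eq alpha beta B : (forall j, B j -> alpha j = beta j) ->
  gen_powers alpha B = gen_powers beta B.
Proof.
move=> h; congr ideal_gen; apply/seteqP.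
by split=> _ [j Bj <-]; exists j => //; rewrite h.
Qed.

Lemma gen_powers_mono alpha B1 B2 : B1 `<=` B2 ->
  gen_powers alpha B1 `<=` gen_powers alpha B2.
Proof. by move=> B12; apply: ideal_gen_mono => _ [j /B12 Bj <-]; exists j. Qed.

Lemma mem_gen_powers (alpha : 'I_d -> nat) (B : set 'I_d) j k :
  B j -> (alpha j <= k)%N ->
  gen_powers alpha B (x j ^+ k).
Proof.
move=> Bj le_k; rewrite -(subnK le_k) exprD.
apply: (mem_idealMl _ (is_ideal_gen_powers _ _)).
by apply: sub_ideal_gen; exists j.
Qed.

(* A product of more than [\sum (alpha j - 1)] generators of [Qs x s] has some
   factor [x j ^+ alpha j]. *)
Lemma Qs_pow_sub_gen_powers (alpha : 'I_d -> nat) s n (hs : (s <= d)%N) :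
  (\sum_(i < s) (alpha (widen_ord hs i)).-1 < n)%N ->
  ideal_pow (Qs x s) n `<=` gen_powers alpha (below s).
Proof.
elim: n alpha => // n IHn alpha hn.
apply: ideal_powS_sub => // a b Qa; rewrite mulrC => Qb.
suff: Qs x s `<=` colon (gen_powers alpha (below s)) b.
  by move=> /(_ _ Qa); rewrite /colon /= mulrC.
apply: ideal_gen_sub; first exact: is_ideal_colon.
move=> _ [j /= lt_js <-]; rewrite /colon /=.
have [le1|gt1] := leqP (alpha j) 1.
  by apply: (mem_idealMr _ (is_ideal_gen_powers _ _)); rewrite -[x j]expr1; exact: mem_gen_powers.
(* The factor [x j] lowers the exponent at [j], and with it the sum of the [alpha i - 1], by one;
   this matches the step from [n.+1] to [n]. *)
pose beta i := if i == j then (alpha j).-1 else alpha i.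
have: gen_powers beta (below s) b.
  apply: IHn Qb => //.
  have E i : ((alpha (widen_ord hs i)).-1 = (beta (widen_ord hs i)).-1 +
                (i == Ordinal lt_js))%N.
    rewrite /beta; have -> : (widen_ord hs i == j) = (i == Ordinal lt_js) by [].
    case: eqP => [->|_]; last by rewrite addn0.
    rewrite (_ : widen_ord hs _ = j); last exact: val_inj.
    by rewrite addn1 prednK //; lia.
  move: hn; rewrite (eq_bigr _ (fun i _ => E i)) big_split /=.
  rewrite [X in (_ + X)%N](bigD1 (Ordinal lt_js)) // eqxx.
  by rewrite (big1 _ (fun i => i != _)) => [|i /negPf->] //=; lia.
rewrite mulrC => gb.
suff: gen_powers beta (below s) `<=` colon (gen_powers alpha (below s)) (x j).
  by move=> /(_ _ gb).
apply: ideal_gen_sub; first exact: is_ideal_colon.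
move=> _ [i /= lt_is <-]; rewrite /colon /= /beta; case: eqP => [->|_].
  rewrite -exprSr prednK; last lia.
  exact: mem_gen_powers.
by apply: (mem_idealMr _ (is_ideal_gen_powers _ _)); exact: mem_gen_powers.
Qed.

Definition kernel_exponent s := (2 ^ s.-1).-1.

(* [kills_intersection s] is the inclusion of [A ^ kernel_exponent s] in the
   annihilator of the quotient of the intersection of all [Qs(gamma)] by
   [Qs ^ n], modulo further parameters indexed by [B]. *)
Definition kills_intersection (s : nat) := forall n alpha (B : set 'I_d) z r,
  (0 < n)%N -> (forall j, (0 < alpha j)%N) -> (forall j, B j -> (s <= j)%N) ->
  (forall (hs : (s <= d)%N) gamma, (forall j, (0 < gamma j)%N) ->
     (forall j, B j -> gamma j = alpha j) ->
     (\sum_(i < s) gamma (widen_ord hs i) = s + n - 1)%N ->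
     gen_powers gamma (below s `|` B) z) ->
  ideal_pow A (kernel_exponent s) r ->
  ideal_add (ideal_pow (Qs x s) n) (gen_powers alpha B) (r * z).

(** The power [l] and the set [B] are there for the telescoping step, which cancels arbitrary powers
    of the next parameter modulo the parameters in [B]. *)
Definition kills_colon (s e : nat) := forall n alpha (B : set 'I_d) (i : 'I_d) l z r,
  (0 < n)%N -> (forall j, (0 < alpha j)%N) -> (forall j, B j -> (s <= j)%N) ->
  (s <= i)%N -> ~ B i -> (0 < l)%N ->
  ideal_add (ideal_pow (Qs x s) n) (gen_powers alpha B) (z * x i ^+ l) ->
  ideal_pow A e r ->
  ideal_add (ideal_pow (Qs x s) n) (gen_powers alpha B) (r * z).

Lemma kills_colon0 : kills_colon 0 1.
Proof.
move=> n alpha B i l z r n0 a0 _ _ nBi l0 hz; rewrite ideal_pow1 // => Ar.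
apply: ideal_addr => //; apply: A_colon nBi l0 _ Ar => //.
have := hz; apply: ideal_add_sub => //.
have sub : ideal_pow (Qs x 0) n `<=` Qs x 0 by exact: ideal_pow_sub.
apply: subset_trans sub _.
by apply: ideal_gen_sub => // ? [].
Qed.

Lemma sum_predn_lt s (f : 'I_s -> nat) n : (0 < n)%N -> (forall i, (0 < f i)%N) ->
  (\sum_(i < s) f i = s + n - 1)%N -> (\sum_(i < s) (f i).-1 < n)%N.
Proof.
move=> n0 f0; rewrite (eq_bigr (fun i => ((f i).-1 + 1)%N)); last first.
  by move=> i _; rewrite addn1 prednK.
by rewrite big_split /= sum1_card card_ord; lia.
Qed.

(** As [Q_s ^ n] lies in every [Q_s(gamma)], one factor from [A] moves [z] into each [Q_s(gamma)],
    modulo [B]; the remaining factors are those of [kills_intersection]. *)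
Lemma kills_intersection_colon s :
  kills_intersection s -> kills_colon s (kernel_exponent s).+1.
Proof.
move=> hK n alpha B i l z r n0 a0 Bs si nBi l0 hz.
suff: ideal_pow A (kernel_exponent s).+1 `<=`
    colon (ideal_add (ideal_pow (Qs x s) n) (gen_powers alpha B)) z by apply.
apply: ideal_powD_sub1 => //; first exact: is_ideal_colon.
move=> a b Aa Ab; rewrite /colon /= -mulrA.
apply: hK Aa => // hs gamma g0 gB gs.
apply: (@A_colon _ _ i l) => //.
  by case=> [lt_is|/nBi//]; move: si; rewrite leqNgt lt_is.
have := hz; apply: ideal_add_sub => //; last first.
  rewrite -(gen_powers_eq gB); apply: gen_powers_mono => j Bj; by right.
apply: subset_trans (@gen_powers_mono _ (below s) _ _); last by move=> j; left.
apply: (@Qs_pow_sub_gen_powers _ _ _ hs); exact: sum_predn_lt gs.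
Qed.

(** The only exponent is [n], so the intersection is already [Q_1 ^ n]; the kernel exponent is 0 and
    [r] is arbitrary. *)
Lemma kills_intersection1 : (0 < d)%N -> kills_intersection 1.
Proof.
move=> d0 n alpha B z r n0 a0 hB hz _.
apply: mem_idealMl => //.
pose gamma (j : 'I_d) := if (j < 1)%N then n else alpha j.
have gB j : B j -> gamma j = alpha j by move=> /hB j0; rewrite /gamma ltnNge j0.
have : gen_powers gamma (below 1 `|` B) z.
  apply: (hz d0) => // [j|]; first by rewrite /gamma; case: ifP.
  by rewrite big_ord1 /gamma /= add1n subn1.
apply: ideal_gen_sub => // _ [j [] hj <-].
  apply: ideal_addl => //; rewrite /gamma hj.
  by apply: mem_ideal_powX; apply: sub_ideal_gen; exists j.
apply: ideal_addr => //; rewrite gB //; exact: mem_gen_powers.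
Qed.

Lemma kills_intersectionS s : (0 < s)%N -> (s < d)%N -> kills_intersection s ->
  kills_intersection s.+1.
Proof.
move=> s0 sd hK n alpha B z r n0 a0 hB hz.
set T := ideal_add _ _.
have hT : is_ideal T by exact: is_ideal_pow_add.
have -> : kernel_exponent s.+1 = ((kernel_exponent s).+1 + kernel_exponent s)%N.
  rewrite /kernel_exponent /= -{1}(prednK s0) expnS.
  have := expn_gt0 2 s.-1; lia.
suff: ideal_pow A ((kernel_exponent s).+1 + kernel_exponent s) `<=` colon T z by apply.
apply: ideal_powD_sub; first exact: is_ideal_colon.
(* Modulo [B], the factor [b] places [b * z] in [Q_s ^ (n + 1 - j) + (x_y ^ j)] for each [j]; the
   factor [a] pays for the cancellations in the telescope. *)
move=> a b Aa Ab; rewrite /colon /= -mulrA /T.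
pose y : 'I_d := Ordinal sd.
have nBy : ~ B y by move=> /hB /=; rewrite ltnn.
have -> : Qs x s.+1 = ideal_gen (Qs x s `|` [set x y]).
  apply/seteqP; split.
    apply: ideal_gen_sub => // _ [j /= lt_js <-]; apply: sub_ideal_gen.
    have [lt|ge] := ltnP j s; first by left; apply: sub_ideal_gen; exists j.
    by right; congr x; apply: val_inj => /=; lia.
  apply: ideal_gen_sub => //; move=> c [|->]; last first.
    by apply: sub_ideal_gen; exists y => /=.
  by apply: ideal_gen_mono c => _ [j /= lt_js <-]; exists j => //=; lia.
apply: ideal_pow_telescope => //.
  move=> c k l k0 l0 hc.
  exact: (kills_intersection_colon hK k0 a0 (fun j Bj => ltnW (hB j Bj)) _ nBy l0 hc).
move=> j /andP[j0 jn].
(* The power [x y ^+ j] is treated as a further parameter, with [y] added to [B]. *)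
pose alpha' i := if i == y then j else alpha i.
have: ideal_add (ideal_pow (Qs x s) (n.+1 - j)) (gen_powers alpha' (y |` B)) (b * z).
  apply: hK Ab; first lia.
  - by move=> i; rewrite /alpha'; case: ifP.
  - by move=> i [->|/hB /ltnW].
  move=> hs gamma g0 gB gs.
  have -> : below s `|` (y |` B) = below s.+1 `|` B.
    rewrite setUA; congr (_ `|` _); apply/seteqP; split=> i; rewrite /below /=.
      by case=> [|->] /=; lia.
    rewrite ltnS leq_eqVlt => /orP[/eqP iy|]; last by left.
    by right; apply: val_inj.
  apply: (hz sd) => // [i Bi|].
    rewrite gB; last by right.
    by rewrite /alpha'; case: eqP => // iy; case: nBy; rewrite -iy.
  (* The tuple for [s] sums to [s + (n + 1 - j) - 1]; with the exponent [j] at [y] the total is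
     [s.+1 + n - 1]. *)
  rewrite big_ord_recr /= (eq_bigr (fun i => gamma (widen_ord hs i))); last first.
    by move=> i _; congr gamma; exact: val_inj.
  rewrite gs (_ : widen_ord sd ord_max = y); last exact: val_inj.
  rewrite gB; last by left.
  rewrite /alpha' eqxx; lia.
have -> : gen_powers alpha' (y |` B) =
    ideal_add (ideal_gen [set x y ^+ j]) (gen_powers alpha B).
  rewrite -ideal_genU; congr ideal_gen; apply/seteqP; split.
    move=> _ [i [->|Bi] <-]; first by left; rewrite /alpha' eqxx.
    right; exists i => //; rewrite /alpha'; case: eqP => // iy.
    by case: nBy; rewrite -iy.
  move=> c [->|[i Bi <-]]; first by exists y; [left|rewrite /alpha' eqxx].
  exists i; first by right.
  by rewrite /alpha'; case: eqP => // iy; case: nBy; rewrite -iy.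
case=> q Qq [c + hc].
have: ideal_gen [set x y ^+ j] `<=` range (fun u => x y ^+ j * u).
  apply: ideal_gen_sub; last by move=> _ ->; exists 1; rewrite ?mulr1.
  split.
  - by exists 0; rewrite ?mulr0.
  - by move=> _ _ [u _ <-] [v _ <-]; exists (u + v); rewrite ?mulrDr.
  - by move=> e _ [u _ <-]; exists (e * u); rewrite // mulrCA.
move=> /[apply] -[u _ cu]; exists u; exists q => //.
by rewrite addrAC cu.
Qed.

Lemma kills_intersection_all s : (0 < s <= d)%N -> kills_intersection s.
Proof.
case: s => // s; elim: s => [|s IHs] /andP[_ sd]; first exact: kills_intersection1.
by apply: kills_intersectionS => //; apply: IHs; exact: ltnW.
Qed.

(** For [s > 0] the exponent is [(kernel_exponent s).+1]; the truncated predecessor makes it 1 at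
    [s = 0], as in [kills_colon0]. An empty [B] removes the auxiliary parameters. *)
Lemma ideal_pow_ann_colon (s : 'I_d) n : (0 < n)%N ->
  ideal_pow A (2 ^ s.-1) `<=`
  ann_ideal_quot (colon (ideal_pow (Qs x s) n) (x s)) (ideal_pow (Qs x s) n).
Proof.
move=> n0 r Ar z; rewrite /colon /= => hz.
have gen0 : gen_powers (fun=> 1%N) set0 = [set 0].
  by rewrite -ideal_gen0; congr ideal_gen; rewrite image_set0.
have hC : kills_colon s (2 ^ s.-1).
  case: (posnP s) => [->|s0]; first exact: kills_colon0.
  have := @kills_intersection_colon s (@kills_intersection_all s _).
  by rewrite /kernel_exponent prednK ?expn_gt0 //; apply; rewrite s0 ltnW.
suff: ideal_add (ideal_pow (Qs x s) n) (gen_powers (fun=> 1%N) set0) (r * z).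
  by rewrite gen0 => -[q + /subr0_eq e]; rewrite -e.
by apply: (hC _ _ _ s 1%N _ _ n0) Ar => //; exact: ideal_addl.
Qed.

Lemma ideal_pow_ann_intersection s (hs : (s <= d)%N) n : (0 < s)%N -> (0 < n)%N ->
  ideal_pow A (kernel_exponent s) `<=`
  ann_ideal_quot (\bigcap_(alpha in Lambda s n) Qs_pow x hs alpha)
                 (ideal_pow (Qs x s) n).
Proof.
move=> s0 n0 r Ar z hz.
have hK : kills_intersection s by apply: kills_intersection_all; rewrite s0.
have gen0 : gen_powers (fun=> 1%N) set0 = [set 0].
  by rewrite -ideal_gen0; congr ideal_gen; rewrite image_set0.
suff: ideal_add (ideal_pow (Qs x s) n) (gen_powers (fun=> 1%N) set0) (r * z).
  by rewrite gen0 => -[q + /subr0_eq e]; rewrite -e.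
apply: (hK _ _ _ _ _ n0) Ar => //.
move=> hs' gamma g0 _ gs; rewrite setU0.
have := hz (fun i => gamma (widen_ord hs i)) _.
have -> : Qs_pow x hs (fun i => gamma (widen_ord hs i)) = gen_powers gamma (below s).
  congr ideal_gen; apply/seteqP; split=> [_ [i _ <-]|_ [j /= js <-]].
    by exists (widen_ord hs i) => //; exact: (ltn_ord i).
  exists (Ordinal js) => //; rewrite (_ : widen_ord hs _ = j) //; exact: val_inj.
apply; split=> //; rewrite -gs; apply: eq_bigr => i _; congr gamma; exact: val_inj.
Qed.

End PowersOfParameters.

(** * Noetherian rings and injective modules *)

Section Submodules.
Local Open Scope ring_scope.
Variables (R : comNzRingType) (V : lmodType R).
Implicit Types (U W Z : set V).

Definition is_submodule U : Prop :=
  [/\ U 0, forall u v, U u -> U v -> U (u + v)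
    & forall (a : R) u, U u -> U (a *: u)].

Lemma submodule0 U : is_submodule U -> U 0. Proof. by case. Qed.
Lemma submoduleD U u v : is_submodule U -> U u -> U v -> U (u + v).
Proof. by case=> _ + _; apply. Qed.
Lemma submoduleZ U a u : is_submodule U -> U u -> U (a *: u).
Proof. by case=> _ _; apply. Qed.
Lemma submoduleB U u v : is_submodule U -> U u -> U v -> U (u - v).
Proof.
by move=> hU Uu Uv; rewrite -scaleN1r; apply: submoduleD => //; exact: submoduleZ.
Qed.

Lemma submodule_sum U (I : finType) (f : I -> V) :
  is_submodule U -> (forall i, U (f i)) -> U (\sum_i f i).
Proof.
move=> hU Uf; elim/big_ind: _ => //; first exact: submodule0.
by move=> *; exact: submoduleD.
Qed.

(** Zorn's lemma with an arbitrary forbidden set; it serves both [torsion_cotrivial_submodule] and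
    the maximal ideal in [local_cancel]. *)
Lemma maximal_submodule_avoiding U (bad : set V) :
  is_submodule U -> (forall u, U u -> ~ bad u) ->
  exists W, [/\ is_submodule W, U `<=` W, forall w, W w -> ~ bad w
    & forall W', is_submodule W' -> W `<=` W' -> (forall w, W' w -> ~ bad w) ->
        W' `<=` W].
Proof.
move=> hU Ubad.
(* The empty set is admitted so that the union of the empty chain qualifies. *)
pose P W := W = set0 \/
  [/\ is_submodule W, U `<=` W & forall w, W w -> ~ bad w].
have [F FP Ftot|W [PW maxW]] := @Zorn_bigcup V P.
  have [[X0 FX0 [x0 X0x0]]|F0] := pselect (exists2 X, F X & X !=set0); last first.
    left; apply/seteqP; split=> // v [X FX Xv].
    by exfalso; apply: F0; exists X => //; exists v.
  have FP' X v : F X -> X v -> [/\ is_submodule X, U `<=` X & forall w, X w -> ~ bad w].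
    by move=> FX Xv; have [E|//] := FP _ FX; rewrite E in Xv.
  right; split.
  - split.
    + by exists X0 => //; apply: submodule0; have [] := FP' _ _ FX0 X0x0.
    + move=> u v [X FX Xu] [Y FY Yv].
      have [XY|YX] := Ftot _ _ FX FY.
        exists Y => //; apply: submoduleD => //; last exact: XY.
        by have [] := FP' _ _ FY Yv.
      exists X => //; apply: submoduleD => //; last exact: YX.
      by have [] := FP' _ _ FX Xu.
    + move=> a u [X FX Xu]; exists X => //; apply: submoduleZ => //.
      by have [] := FP' _ _ FX Xu.
  - by move=> u Uu; exists X0 => //; have [_ + _] := FP' _ _ FX0 X0x0; apply.
  - by move=> w [X FX Xw]; have [_ _] := FP' _ _ FX Xw; apply.
have PU : P U by right; split.
case: PW => [W0|[hW UW Wbad]].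
  exfalso; apply: (maxW U) => //; rewrite W0; split=> //.
  by move=> /(_ 0 (submodule0 hU)).
exists W; split=> // W' hW' WW' W'bad; apply: contrapT => W'W.
by apply: (maxW W') => //; right; split=> // u /UW /WW'.
Qed.

End Submodules.

(** * Consequences of the ascending chain condition *)

Section Noetherian.
Local Open Scope ring_scope.
Variables (R : comNzRingType) (noethR : noetherian R).

Lemma noetherian_stationary (I : nat -> set R) :
  (forall k, is_ideal (I k)) -> (forall k, I k `<=` I k.+1) ->
  exists k, forall l, I l `<=` I k.
Proof.
move=> hI incI.
have mono k l : (k <= l)%N -> I k `<=` I l.
  by move=> /subnK <-; elim: (l - k)%N => // n IHn x /IHn /incI.
have hU : is_ideal (\bigcup_k I k).
  split.
  - by exists 0%N => //; exact: mem_ideal0.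
  - move=> x y [k _ Ix] [l _ Iy]; exists (maxn k l) => //; apply: mem_idealD => //.
      exact: mono (leq_maxl _ _) _ Ix.
    exact: mono (leq_maxr _ _) _ Iy.
  - by move=> a x [k _ Ix]; exists k => //; exact: mem_idealMl.
have [s Us] := noethR hU.
have [k sk] : exists k, [set` s] `<=` I k.
  have : [set` s] `<=` \bigcup_k I k by rewrite Us; exact: sub_ideal_gen.
  elim: s {Us} => [|x s IHs] sU; first by exists 0%N.
  have [|k sk] := IHs; first by move=> y ys; apply: sU; rewrite /= inE ys orbT.
  have [|l _ xl] := sU x; first by rewrite /= inE eqxx.
  exists (maxn k l) => y; rewrite /= inE => /orP[/eqP ->|ys].
    exact: mono (leq_maxr _ _) _ xl.
  by apply: (mono _ _ (leq_maxl _ _)); exact: sk.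
exists k => l x Ix; suff: (\bigcup_k I k) x.
  by rewrite Us; apply: ideal_gen_sub.
by exists l.
Qed.

(* A substitute for the Artin-Rees lemma: [W] plays the role of [m ^ k V], which
   meets [Z] inside [Z0] for large [k]. *)
Lemma torsion_cotrivial_submodule (V : lmodType R) (Z Z0 : set V) (X : set R) :
  is_submodule Z -> is_submodule Z0 ->
  (forall x z, X x -> Z z -> exists k, Z0 (x ^+ k *: z)) ->
  exists W, [/\ is_submodule W, Z0 `<=` W, forall w, W w -> Z w -> Z0 w
    & forall x v, X x -> exists k, W (x ^+ k *: v)].
Proof.
move=> hZ hZ0 htors.
have [|W [hW Z0W Wbad maxW]] :=
  @maximal_submodule_avoiding R V Z0 [set z | Z z /\ ~ Z0 z] hZ0.
  by move=> z Z0z [].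
have WZ w : W w -> Z w -> Z0 w.
  by move=> Ww Zw; apply: contrapT => nZ0w; apply: (Wbad _ Ww).
exists W; split=> // x v Xx.
(* By the chain condition, the ideals of those [r] that carry [x ^+ k *: v] into [W] become
   constant. *)
have [k|k r|k kmax] := @noetherian_stationary (fun k => [set r | W (r *: (x ^+ k *: v))]).
- split=> /=.
  + by rewrite scale0r; exact: submodule0.
  + by move=> a b Wa Wb; rewrite scalerDl; exact: submoduleD.
  + by move=> a b Wb; rewrite -scalerA; exact: submoduleZ.
- move=> /= Wr; rewrite exprS -scalerA [r *: _]scalerA mulrC -scalerA.
  exact: submoduleZ.
exists k; pose W' := [set w | exists r, W (w - r *: (x ^+ k *: v))].
suff sub : W' `<=` W by apply: sub; exists 1; rewrite scale1r subrr; exact: submodule0.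
apply: maxW.
- split.
  + by exists 0; rewrite scale0r subrr; exact: submodule0.
  + move=> w1 w2 [r1 W1] [r2 W2]; exists (r1 + r2).
    by rewrite scalerDl opprD addrACA; exact: submoduleD.
  + move=> a w [r Ww]; exists (a * r); rewrite -scalerA -scalerBr.
    exact: submoduleZ.
- by move=> w Ww; exists 0; rewrite scale0r subr0.
move=> z [r Wz] [Zz]; apply; apply: (WZ) => //.
have [N Z0N] := htors x z Xx Zz.
suff: W (r *: (x ^+ k *: v)) by move=> /(submoduleD hW Wz); rewrite subrK.
(* [x ^+ N *: z] lies in [Z0], hence in [W], so [x ^+ N] carries [r *: (x ^+ k *: v)] into [W];
   stability then drops the factor [x ^+ N]. *)
apply: (kmax (k + N)%N).
have := submoduleB hW (Z0W _ Z0N) (submoduleZ (x ^+ N) hW Wz).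
rewrite /= -scalerBr opprB addrC subrK.
suff -> : x ^+ N *: (r *: (x ^+ k *: v)) = r *: (x ^+ (k + N) *: v) by [].
by rewrite !scalerA exprD; congr (_ *: v); ring.
Qed.

End Noetherian.

(** * Extension of linear maps into injective modules *)

Section LinearExtension.
Local Open Scope ring_scope.
Variable R : comNzRingType.

Definition linear_of (U V : lmodType R) (f : U -> V) (hf : linear f) :
  {linear U -> V} := HB.pack f (GRing.isLinear.Build R U V *:%R f hf).

Section SubmoduleType.
Variables (V : lmodType R) (U : set V).

Definition submodule_pred of is_submodule U : {pred V} := fun v => `[< U v >].

Variable hU : is_submodule U.

Fact submodule_pred_closed : submod_closed (submodule_pred hU).
Proof.
split=> [|a u v /asboolP Uu /asboolP Uv]; apply/asboolP; first exact: submodule0.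
by apply: submoduleD => //; exact: submoduleZ.
Qed.
HB.instance Definition _ :=
  GRing.isSubmodClosed.Build R V (submodule_pred hU) submodule_pred_closed.

Inductive submodule_type := SubmoduleType v of v \in submodule_pred hU.
Definition submodule_val (w : submodule_type) := let: SubmoduleType v _ := w in v.
HB.instance Definition _ := [isSub for submodule_val].
HB.instance Definition _ := [Choice of submodule_type by <:].
HB.instance Definition _ := [SubChoice_isSubLmodule of submodule_type by <:].

Lemma submodule_valP (w : submodule_type) : U (val w).
Proof. by case: w => v Uv; apply/asboolP. Qed.

End SubmoduleType.

(* [G] is the graph of a linear map defined on a submodule of [N]. *)
Lemma injective_extension (N E : lmodType R) (G : set (N * E)) :
  injective_module E -> is_submodule G -> (forall e, G (0, e) -> e = 0) ->
  exists h : {linear N -> E}, forall n e, G (n, e) -> h n = e.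
Proof.
move=> hE hG G0.
have lin1 : linear (fun w : submodule_type hG => (val w).1).
  by move=> a u v; rewrite linearP.
have lin2 : linear (fun w : submodule_type hG => (val w).2).
  by move=> a u v; rewrite linearP.
have inj1 : injective (linear_of lin1).
  move=> u v /= uv.
  have : G ((val u).1 - (val v).1, (val u).2 - (val v).2).
    by apply: (submoduleB hG (submodule_valP u) (submodule_valP v)).
  rewrite uv subrr => /G0/subr0_eq uv2.
  by apply: val_inj; rewrite [LHS]surjective_pairing uv uv2 -surjective_pairing.
have [h hh] := hE _ _ _ (linear_of lin2) inj1.
exists h => n e /asboolP Gne; exact: hh (SubmoduleType Gne).
Qed.

(** The pairs [(f u, g u)] form a graph once the kernel of [f] lies in that of [g]; [f] itself may
    fail to be injective. *)
Lemma injective_factor (M N E : lmodType R) (f : {linear M -> N})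
    (g : {linear M -> E}) : injective_module E ->
  (forall u, f u = 0 -> g u = 0) -> exists h : {linear N -> E}, forall u, h (f u) = g u.
Proof.
move=> hE kerfg.
pose G : set (N * E) := range (fun u => (f u, g u)).
have [||h hG] := @injective_extension N E G hE.
- split; first by exists 0; rewrite ?linear0.
  + move=> _ _ [u _ <-] [v _ <-]; exists (u + v) => //; by rewrite !linearD.
  + move=> a _ [u _ <-]; exists (a *: u) => //; by rewrite !linearZ.
- by move=> e [u _ [/kerfg <- <-]].
by exists h => u; apply: hG; exists u.
Qed.

End LinearExtension.

(** * Local cohomology *)

Section Torsion.
Local Open Scope ring_scope.
Variable R : comNzRingType.

(** Pigeonhole: among [a + b] factors taken from [K] or equal to [y], either [a] lie in [K] or [b]
    equal [y]. The induction strips the first factor and passes to a colon ideal. *)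
Lemma ideal_powD_sub_gen (I K : set R) (y : R) a b :
  is_ideal I -> ideal_pow K a `<=` I -> I (y ^+ b) ->
  ideal_pow (ideal_gen (K `|` [set y])) (a + b) `<=` I.
Proof.
move=> hI; move Dt: (a + b)%N => t; elim: t I a b hI Dt => [|t IHt] I a b hI Dt KI yI.
  by move: KI; rewrite (_ : a = 0)%N //; lia.
apply: ideal_powS_sub => // l w Ll Lw.
suff: ideal_gen (K `|` [set y]) `<=` colon I w by apply.
apply: ideal_gen_sub; first exact: is_ideal_colon.
move=> c [Kc|->]; rewrite /colon /= mulrC.
  case: a => [|a] in Dt KI; first by apply: mem_idealMr => //; apply: KI.
  apply: (IHt (colon I c) a b) Lw; rewrite /colon //=; first exact: is_ideal_colon.
  - by lia.
  - by move=> e Ke /=; rewrite mulrC; apply: KI; exact: mem_ideal_powS.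
  - exact: mem_idealMr.
case: b => [|b] in Dt yI.
  by apply: mem_idealMr => //; rewrite -[w]mulr1; exact: mem_idealMl.
apply: (IHt (colon I y) a b) Lw; rewrite /colon //=; first exact: is_ideal_colon.
- by lia.
- by move=> e /KI Ie /=; exact: mem_idealMr.
- by rewrite -exprSr.
Qed.

Lemma ideal_pow_sub_of_generators (I : set R) (s : seq R) : is_ideal I ->
  (forall y, y \in s -> exists k, I (y ^+ k)) ->
  exists n, ideal_pow (ideal_gen [set` s]) n `<=` I.
Proof.
move=> hI; elim: s => [|y s IHs] sI.
  exists 1%N; rewrite ideal_pow1 //; exact: ideal_gen_sub.
have [|a sa] := IHs; first by move=> z zs; apply: sI; rewrite inE zs orbT.
have [|b yb] := sI y; first by rewrite inE eqxx.
exists (a + b)%N; apply: subset_trans (ideal_powD_sub_gen hI sa yb).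
apply: ideal_pow_mono; apply: ideal_gen_sub => // z; rewrite /= inE => /orP[/eqP->|zs].
  by apply: (@sub_ideal_gen R); right.
by apply: sub_ideal_gen; left; exact: sub_ideal_gen.
Qed.

Lemma is_ideal_radical (I : set R) : is_ideal I -> is_ideal (radical I).
Proof.
move=> hI; split.
- by exists 1%N; rewrite expr1; exact: mem_ideal0.
- move=> x y Ix Iy.
  have [|n hn] := @ideal_pow_sub_of_generators I [:: x; y] hI.
    by move=> z; rewrite !inE => /orP[]/eqP->.
  exists n; apply: hn; apply: mem_ideal_powX; apply: (mem_idealD (is_ideal_gen _));
    by apply: sub_ideal_gen; rewrite /= !inE eqxx ?orbT.
- by move=> a x [k Ik]; exists k; rewrite exprMn; exact: mem_idealMl.
Qed.

Lemma sub_radical (I : set R) : I `<=` radical I.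
Proof. by move=> x Ix; exists 1%N; rewrite expr1. Qed.

Variable m : set R.

Lemma torsion_submodule (M : lmodType R) : is_submodule (torsion m M).
Proof.
split.
- by exists 0%N => r _; rewrite scaler0.
- move=> u v [k uk] [l vl]; exists (maxn k l) => r mr.
  by rewrite scalerDr uk ?vl ?addr0 //; apply: ideal_pow_le mr; lia.
- by move=> a u [k uk]; exists k => r mr; rewrite scalerA mulrC -scalerA uk ?scaler0.
Qed.
Hint Resolve torsion_submodule : core.

Lemma torsion_linear (M N : lmodType R) (f : {linear M -> N}) z :
  torsion m M z -> torsion m N (f z).
Proof. by case=> n zn; exists n => r mr; rewrite -linearZ /= zn ?linear0. Qed.

Lemma torsion_linear_inj (M N : lmodType R) (f : {linear M -> N}) z :
  injective f -> torsion m N (f z) -> torsion m M z.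
Proof.
move=> f_inj [n zn]; exists n => r mr; apply: f_inj.
by rewrite linearZ /= zn ?linear0.
Qed.

Lemma torsion_exp (M : lmodType R) x z : m x -> torsion m M z ->
  exists k, x ^+ k *: z = 0.
Proof. by move=> mx [k zk]; exists k; apply: zk; exact: mem_ideal_powX. Qed.

(** Every element of [m] has a power in the annihilator of [z]; as [m] is finitely generated, some
    power of [m] lies there. *)
Lemma exp_torsion (M : lmodType R) (X : set R) z : noetherian R ->
  m = radical (ideal_gen X) -> (forall x, X x -> exists k, x ^+ k *: z = 0) ->
  torsion m M z.
Proof.
move=> noethR Dm Xz.
pose I : set R := [set r | r *: z = 0].
have hI : is_ideal I.
  split; rewrite /I /=; first by rewrite scale0r.
  - by move=> a b az bz; rewrite scalerDl az bz addr0.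
  - by move=> a b bz; rewrite -scalerA bz scaler0.
have hm : is_ideal m by rewrite Dm; exact: is_ideal_radical.
have mI y : m y -> exists k, I (y ^+ k).
  rewrite Dm => -[k yk].
  have: radical I (y ^+ k).
    by have := yk; apply: ideal_gen_sub; [exact: is_ideal_radical | exact: Xz].
  by case=> l; rewrite -exprM; exists (k * l)%N.
have [s ms] := noethR m hm.
have [|n hn] := @ideal_pow_sub_of_generators I s hI.
  by move=> y ys; apply: mI; rewrite ms; exact: sub_ideal_gen.
by exists n => r; rewrite ms => /hn.
Qed.

End Torsion.
#[export] Hint Resolve torsion_submodule : core.

(** * Comparison of injective resolutions *)

Section Comparison.
Local Open Scope ring_scope.
Variables (R : comNzRingType) (M : lmodType R).

Lemma res_d_aug (I : inj_resolution M) y : res_d I 0 (res_aug I y) = 0.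
Proof. by apply/res_exact0; exists y. Qed.

Lemma res_dd (I : inj_resolution M) i w : res_d I i.+1 (res_d I i w) = 0.
Proof. by apply/res_exactS; exists w. Qed.

Lemma chain_map_lift (I J : inj_resolution M) i
    (g : {linear res_obj I i -> res_obj J i}) :
  (forall z, res_d I i z = 0 -> res_d J i (g z) = 0) ->
  exists h : {linear res_obj I i.+1 -> res_obj J i.+1},
    forall u, h (res_d I i u) = res_d J i (g u).
Proof.
move=> g0.
have lin : linear (fun w => res_d J i (g w)) by move=> a u v; rewrite !linearP.
by apply: (injective_factor (g := linear_of lin)) => //; exact: res_injective.
Qed.

(* [phi] and [psi] are the degree [i] parts of chain maps between the two
   resolutions, and [S] that of a homotopy from the identity to [psi \o phi]. *)
Lemma resolution_comparison (I J : inj_resolution M) i :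
  exists (phi : {linear res_obj I i -> res_obj J i})
         (psi : {linear res_obj J i -> res_obj I i})
         (S : {linear res_obj I i.+1 -> res_obj I i}),
  [/\ forall z, res_d I i z = 0 -> res_d J i (phi z) = 0,
      forall z, res_d J i z = 0 -> res_d I i (psi z) = 0
    & forall w, res_d I i (S (res_d I i w)) = res_d I i (psi (phi w) - w)].
Proof.
have factor0 (K K' : inj_resolution M) :
    exists h : {linear res_obj K 0 -> res_obj K' 0}, forall u, h (res_aug K u) = res_aug K' u.
  apply: injective_factor; first exact: res_injective.
  by move=> u; rewrite -(linear0 (res_aug K)) => /res_aug_inj ->; rewrite linear0.
elim: i => [|i [phi [psi [S [phi0 psi0 hS]]]]].
  have [phi hphi] := factor0 I J; have [psi hpsi] := factor0 J I.
  have lin : linear (fun w => psi (phi w) - w).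
    by move=> a u v; rewrite !linearP scalerDr addrACA.
  have [|S hS] := @injective_factor R _ _ _ (res_d I 0) (linear_of lin) (@res_injective _ _ I 0).
    by move=> u /res_exact0[y <-] /=; rewrite hphi hpsi subrr.
  exists phi, psi, S; split=> [z /res_exact0[y <-]|z /res_exact0[y <-]|w].
  - by rewrite hphi res_d_aug.
  - by rewrite hpsi res_d_aug.
  - by rewrite hS.
have [phi' hphi'] := chain_map_lift phi0; have [psi' hpsi'] := chain_map_lift psi0.
(* This map vanishes on the image of [res_d I i], so it factors through the next differential; the
   factor is the new homotopy. *)
have lin : linear (fun w => psi' (phi' w) - w - res_d I i (S w)).
  by move=> a u v; rewrite !linearP !scalerDr [X in X + _ = _]addrACA [LHS]addrACA.
have [|S' hS'] := @injective_factor R _ _ _ (res_d I i.+1) (linear_of lin)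
    (@res_injective _ _ I i.+1).
  move=> u /res_exactS[w <-] /=.
  by rewrite hphi' hpsi' hS linearB subrr.
exists phi', psi', S'; split=> [z /res_exactS[y <-]|z /res_exactS[y <-]|w].
- by rewrite hphi' res_dd.
- by rewrite hpsi' res_dd.
- by rewrite hS' /= linearB /= res_dd subr0.
Qed.

(** In positive degree the annihilation is transported along the comparison maps; in degree 0 both
    cohomology modules are the torsion of [M]. *)
Lemma ann_lc_any_resolution (m : set R) i r (I : inj_resolution M) :
  ann_lc m M i r -> ann_quot (lc_cocycle m I i) (lc_coboundary m I i) r.
Proof.
case=> J; case: i => [|i] hJ z [/= mz].
  move=> /res_exact0[y yz]; rewrite -yz in mz *.
  have my : torsion m M y by apply: torsion_linear_inj mz; exact: res_aug_inj.
  have : res_aug J (r *: y) = 0.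
    by rewrite linearZ /=; apply: hJ; split; [exact: torsion_linear | exact: res_d_aug].
  rewrite -(linear0 (res_aug J)) => /res_aug_inj ry.
  by rewrite -linearZ /= ry linear0.
move=> /res_exactS[w wz].
have [phi [psi [S [phi0 psi0 hS]]]] := resolution_comparison I J i.
have [phi' hphi'] := chain_map_lift phi0; have [psi' hpsi'] := chain_map_lift psi0.
have [|t mt tz] := hJ (phi' z).
  by split; [exact: torsion_linear | rewrite -wz hphi' res_dd].
(* The differential of [psi t] is [r psi'(phi' z)] and that of [S z] is [psi'(phi' z) - z], so the
   difference has differential [r z]. *)
exists (psi t - r *: S z).
  apply: submoduleB => //; first exact: torsion_linear.
  by apply: submoduleZ => //; exact: torsion_linear.
rewrite linearB /= -hpsi' tz !linearZ /= -scalerDr -wz; congr (r *: _).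
by rewrite hS hphi' hpsi' linearB subKr.
Qed.

End Comparison.

(** * Annihilators of the cohomology of free complexes *)

Section MatrixAction.
Local Open Scope ring_scope.
Variables (R : comNzRingType).

(** Precomposition with [D]: a tuple [f] stands for the linear map ['rV_b -> E] with these values on
    the standard basis, so differentials of [Hom (K, E)] have this form. *)
Definition mxact (E : lmodType R) a b (D : 'M[R]_(a, b)) (f : 'I_b -> E) : 'I_a -> E :=
  fun i => \sum_j D i j *: f j.

Lemma mxact_mul (E : lmodType R) a b c (D1 : 'M[R]_(a, b)) (D2 : 'M[R]_(b, c))
    (f : 'I_c -> E) i : mxact (D1 *m D2) f i = mxact D1 (mxact D2 f) i.
Proof.
rewrite /mxact; under eq_bigr do rewrite mxE scaler_suml.
rewrite exchange_big /=; apply: eq_bigr => j _; rewrite scaler_sumr.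
by apply: eq_bigr => k _; rewrite scalerA.
Qed.

Lemma eq_mxact (E : lmodType R) a b (D : 'M[R]_(a, b)) (f g : 'I_b -> E) i :
  f =1 g -> mxact D f i = mxact D g i.
Proof. by move=> fg; apply: eq_bigr => j _; rewrite fg. Qed.

Lemma mxact0 (E : lmodType R) a b (f : 'I_b -> E) i : mxact (0 : 'M[R]_(a, b)) f i = 0.
Proof. by apply: big1 => j _; rewrite mxE scale0r. Qed.

Lemma mxactDl (E : lmodType R) a b (D1 D2 : 'M[R]_(a, b)) (f : 'I_b -> E) i :
  mxact (D1 + D2) f i = mxact D1 f i + mxact D2 f i.
Proof. by rewrite -big_split; apply: eq_bigr => j _; rewrite mxE scalerDl. Qed.

Lemma mxactZl (E : lmodType R) a b r (D : 'M[R]_(a, b)) (f : 'I_b -> E) i :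
  mxact (r *: D) f i = r *: mxact D f i.
Proof. by rewrite scaler_sumr; apply: eq_bigr => j _; rewrite mxE scalerA. Qed.

Lemma mxactDr (E : lmodType R) a b (D : 'M[R]_(a, b)) (f g : 'I_b -> E) i :
  mxact D (fun j => f j + g j) i = mxact D f i + mxact D g i.
Proof. by rewrite -big_split; apply: eq_bigr => j _; rewrite scalerDr. Qed.

Lemma mxact_linear (E E' : lmodType R) (h : {linear E -> E'}) a b
    (D : 'M[R]_(a, b)) (f : 'I_b -> E) i :
  h (mxact D f i) = mxact D (fun j => h (f j)) i.
Proof. by rewrite linear_sum; apply: eq_bigr => j _; rewrite linearZ. Qed.

Lemma mxactZr (E : lmodType R) a b r (D : 'M[R]_(a, b)) (f : 'I_b -> E) i :
  mxact D (fun j => r *: f j) i = r *: mxact D f i.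
Proof.
by rewrite scaler_sumr; apply: eq_bigr => j _; rewrite !scalerA mulrC.
Qed.

Lemma submodule_mxact (E : lmodType R) (U : set E) a b (D : 'M[R]_(a, b))
    (f : 'I_b -> E) i : is_submodule U -> (forall j, U (f j)) -> U (mxact D f i).
Proof. by move=> hU Uf; apply: submodule_sum => // j; exact: submoduleZ. Qed.

Lemma mxact_delta (E : lmodType R) a b (D : 'M[R]_(a, b)) (f : 'I_b -> E) i :
  mxact (delta_mx 0 i *m D : 'rV_b) f 0 = mxact D f i.
Proof. by apply: eq_bigr => j _; rewrite -rowE mxE. Qed.

Lemma mxact_delta1 (E : lmodType R) b (f : 'I_b -> E) i :
  mxact (delta_mx 0 i : 'rV_b) f 0 = f i.
Proof.
rewrite /mxact (bigD1 i) //= mxE !eqxx scale1r big1 ?addr0 // => j /negPf ji.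
by rewrite mxE ji andbF scale0r.
Qed.

Lemma linear_mxact (E : lmodType R) b (h : {linear 'rV[R]_b -> E}) (v : 'rV[R]_b) :
  h v = mxact v (fun j => h (delta_mx 0 j)) 0.
Proof.
by rewrite {1}[v]row_sum_delta linear_sum; apply: eq_bigr => j _; rewrite linearZ.
Qed.

End MatrixAction.

(* [D] is a complex of free modules indexed so that its first nonzero term has
   index 1, and multiplication by every element of [X] is null-homotopic on it. *)
Section FreeComplex.
Local Open Scope ring_scope.
Variables (R : comNzRingType) (m X : set R).
Hypothesis noethR : noetherian R.
Hypothesis Dm : m = radical (ideal_gen X).
Variables (n : nat -> nat) (D : forall p, 'M[R]_(n p.+1, n p)).
Hypothesis n0 : n 0 = 0%N.
Hypothesis DD : forall p, D p.+1 *m D p = 0.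
Hypothesis homotopyD : forall x p, X x ->
  exists (S' : 'M[R]_(n p.+1, n p.+2)) (S : 'M[R]_(n p, n p.+1)),
    S' *m D p.+1 + D p *m S = x%:M.

(* The complex of functions with values in [E / torsion E] is exact. *)
Lemma torsion_decomposition (E : lmodType R) p (zeta : 'I_(n p.+1) -> E) :
  injective_module E -> (forall i, torsion m E (mxact (D p.+1) zeta i)) ->
  exists (g : 'I_(n p.+1) -> E) (h : 'I_(n p) -> E),
    (forall j, torsion m E (g j)) /\ forall j, zeta j = g j + mxact (D p) h j.
Proof.
move=> hE tors.
have Xm x : X x -> m x.
  by move=> Xx; rewrite Dm; apply: sub_radical; exact: sub_ideal_gen.
pose ev (f : 'I_(n p.+1) -> E) (v : 'rV[R]_(n p.+1)) := mxact v f 0.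
have evD f u v : ev f (u + v) = ev f u + ev f v by exact: mxactDl.
have evZ f a u : ev f (a *: u) = a *: ev f u by exact: mxactZl.
have ev0 f : ev f 0 = 0 by exact: mxact0.
(* The torsion-valued [g] is to agree with [zeta] on the cycles [Z]; [Z0] consists of the cycles on
   which [zeta] vanishes. *)
pose Z := [set v : 'rV[R]_(n p.+1) | v *m D p = 0].
pose Z0 := [set v : 'rV[R]_(n p.+1) | Z v /\ ev zeta v = 0].
have hZ : is_submodule Z.
  split; rewrite /Z /=; first by rewrite mul0mx.
  - by move=> u v u0 v0; rewrite mulmxDl u0 v0 addr0.
  - by move=> a u u0; rewrite -scalemxAl u0 scaler0.
have hZ0 : is_submodule Z0.
  split; rewrite /Z0 /=; first by split; [exact: submodule0 | exact: ev0].
  - move=> u v [Zu u0] [Zv v0]; split; first exact: submoduleD.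
    by rewrite evD u0 v0 addr0.
  - move=> a u [Zu u0]; split; first exact: submoduleZ.
    by rewrite evZ u0 scaler0.
(* By the homotopy [x *: z] is a boundary, and there [zeta] takes torsion values. *)
have Ztors x z : X x -> Z z -> exists k, Z0 (x ^+ k *: z).
  move=> Xx Zz; have [S' [S xSS]] := homotopyD p Xx.
  have xz : x *: z = (z *m S') *m D p.+1.
    by rewrite -mul_mx_scalar -xSS mulmxDr !mulmxA Zz mul0mx addr0.
  have : torsion m E (ev zeta (x *: z)).
    by rewrite xz /ev mxact_mul; exact: submodule_mxact.
  case/(torsion_exp (Xm _ Xx)) => k xk; exists k.+1; split; first exact: submoduleZ.
  by rewrite exprSr -scalerA evZ.
have [W [hW Z0W WZ Wcot]] := torsion_cotrivial_submodule noethR hZ hZ0 Ztors.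
(* The graph of the map that is [zeta] on [Z] and 0 on [W], single-valued because [W] meets [Z]
   inside [Z0]. *)
pose G : set ('rV[R]_(n p.+1) * E) :=
  [set ve | exists z w, [/\ Z z, W w, ve.1 = z + w & ve.2 = ev zeta z]].
have hG : is_submodule G.
  split.
  - by exists 0, 0; split; rewrite ?addr0 ?ev0 //; exact: submodule0.
  - move=> [v1 e1] [v2 e2] [z1 [w1 [/= Zz1 Ww1 -> ->]]] [z2 [w2 [/= Zz2 Ww2 -> ->]]].
    exists (z1 + z2), (w1 + w2); split=> /=; try exact: submoduleD.
      by rewrite addrACA.
    by rewrite evD.
  - move=> a [v e] [z [w [/= Zz Ww -> ->]]]; exists (a *: z), (a *: w).
    by split=> /=; rewrite ?scalerDr ?evZ //; exact: submoduleZ.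
have [|g1 hg1] := injective_extension hE hG.
  move=> e [z [w [/= Zz Ww zw ->]]].
  have Wz : W z.
    rewrite (_ : z = 0 - w); first exact: submoduleB (submodule0 hW) Ww.
    by rewrite zw addrK.
  by have [] := WZ _ Wz Zz.
pose g j := g1 (delta_mx 0 j).
have evg v : ev g v = g1 v by rewrite linear_mxact.
have gtors j : torsion m E (g j).
  apply: (exp_torsion noethR Dm) => x Xx; have [k Wk] := Wcot x (delta_mx 0 j) Xx.
  exists k; rewrite -linearZ /=; apply: hg1; exists 0, (x ^+ k *: delta_mx 0 j).
  by split; rewrite /= ?add0r ?ev0 //; exact: submodule0.
(* [zeta - g] vanishes on cycles, so it factors through [D p] and yields [h]. *)
pose G' : set ('rV[R]_(n p) * E) := range (fun v => (v *m D p, ev zeta v - ev g v)).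
have hG' : is_submodule G'.
  split.
  - by exists 0 => //; rewrite mul0mx !ev0 subr0.
  - move=> _ _ [u _ <-] [v _ <-]; exists (u + v) => //.
    by rewrite mulmxDl !evD opprD addrACA.
  - move=> a _ [u _ <-]; exists (a *: u) => //.
    by rewrite -scalemxAl !evZ -scalerBr.
have [|h1 hh1] := injective_extension hE hG'.
  move=> e [v _ [v0 <-]]; rewrite evg (_ : g1 v = ev zeta v) ?subrr //.
  by apply: hg1; exists v, 0; split; rewrite ?addr0 //; exact: submodule0.
exists g, (fun j => h1 (delta_mx 0 j)); split=> // j.
rewrite -mxact_delta -linear_mxact.
rewrite (hh1 _ (ev zeta (delta_mx 0 j) - ev g (delta_mx 0 j))); last first.
  by exists (delta_mx 0 j).
by rewrite /ev !mxact_delta1 addrC subrK.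
Qed.

Variables (M : lmodType R) (I : inj_resolution M).

(** One rung of the zigzag: the degree in the resolution drops by one while the differential in the
    free direction stays torsion, at the cost of the factor [r]. *)
Definition torsion_lift p q (r : R) := forall zeta : 'I_(n p) -> res_obj I q.+1,
  (forall j, res_d I q.+1 (zeta j) = 0) ->
  (forall i, torsion m (res_obj I q.+1) (mxact (D p) zeta i)) ->
  exists s : 'I_(n p) -> res_obj I q,
    (forall j, res_d I q (s j) = r *: zeta j) /\
    forall i, torsion m (res_obj I q) (mxact (D p) s i).

Lemma torsion_lift0 q r : torsion_lift 0 q r.
Proof.
move=> zeta _ _; exists (fun=> 0); split.
  by case=> j lt_j; exfalso; rewrite n0 in lt_j.
by move=> i; apply: submodule_mxact => // j; exact: submodule0.
Qed.

(** In [zeta = g + D h] the parts need not be cocycles. As [D (d h) = - d g] is torsion,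
    [torsion_lift] gives [s] with [d s = r d h], and moving [D s] from one part to the other repairs
    both. *)
Lemma torsion_lift_decomposition p q r (zeta : 'I_(n p.+1) -> res_obj I q) :
  torsion_lift p q r -> (forall j, res_d I q (zeta j) = 0) ->
  (forall i, torsion m (res_obj I q) (mxact (D p.+1) zeta i)) ->
  exists (g : 'I_(n p.+1) -> res_obj I q) (eta : 'I_(n p) -> res_obj I q),
  [/\ forall j, lc_cocycle m I q (g j), forall j, res_d I q (eta j) = 0
    & forall j, r *: zeta j = g j + mxact (D p) eta j].
Proof.
move=> hP zeta0 tors.
have [g [h [gtors zgh]]] := torsion_decomposition (@res_injective _ _ I q) tors.
have dg j : res_d I q (g j) = - mxact (D p) (fun i => res_d I q (h i)) j.
  apply/eqP; rewrite -addr_eq0 -mxact_linear -linearD /= -zgh.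
  by rewrite zeta0.
have [||s [ds stors]] := hP (fun i => res_d I q (h i)).
- by move=> j; rewrite res_dd.
- move=> i; rewrite -[mxact _ _ _]opprK -dg -scaleN1r.
  by apply: submoduleZ => //; exact: torsion_linear.
exists (fun j => r *: g j + mxact (D p) s j), (fun j => r *: h j - s j).
have eta0 j : res_d I q (r *: h j - s j) = 0.
  by rewrite linearB linearZ /= ds subrr.
have E j : r *: zeta j = r *: g j + mxact (D p) s j +
    mxact (D p) (fun j => r *: h j - s j) j.
  rewrite -addrA -mxactDr zgh scalerDr; congr (_ + _); rewrite -mxactZr.
  by apply: eq_mxact => i; rewrite addrC subrK.
split=> // j; split.
  by apply: submoduleD => //; exact: submoduleZ.
have := congr1 (res_d I q) (E j); rewrite linearZ /= zeta0 scaler0 linearD /=.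
rewrite [X in _ + X]mxact_linear (eq_mxact _ _ eta0) => ->.
suff -> : mxact (D p) (fun=> 0 : res_obj I q.+1) j = 0 by rewrite addr0.
by apply: big1 => i _; rewrite scaler0.
Qed.

(** Thanks to [r], the part [g] bounds in the torsion complex; [eta] bounds by exactness of the
    resolution, and its contribution dies under the next differential because [D D = 0]. *)
Lemma torsion_liftS p q r r' : torsion_lift p q.+1 r' ->
  ann_quot (lc_cocycle m I q.+1) (lc_coboundary m I q.+1) r ->
  torsion_lift p.+1 q (r * r').
Proof.
move=> hP hr zeta zeta0 tors.
have [g [eta [gZ eta0 zge]]] := torsion_lift_decomposition hP zeta0 tors.
have /choice[t ht] j : exists t, torsion m _ t /\ res_d I q t = r *: g j.
  by have [t mt tg] := hr _ (gZ j); exists t.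
have /choice[u hu] j : exists u, res_d I q u = eta j.
  by apply/res_exactS.
exists (fun j => t j + r *: mxact (D p) u j); split=> [j|i].
  rewrite linearD linearZ /= (ht j).2 mxact_linear (eq_mxact _ _ hu).
  by rewrite -scalerDr -zge scalerA.
rewrite mxactDr mxactZr -mxact_mul DD mxact0 scaler0 addr0.
by apply: submodule_mxact => // j; case: (ht j).
Qed.

Theorem prod_ann_lc_cohomology (r : nat -> R) p (v : 'I_(n p.+1) -> M) :
  (forall q, (q <= p)%N -> ann_quot (lc_cocycle m I q) (lc_coboundary m I q) (r q)) ->
  (forall i, mxact (D p.+1) v i = 0) ->
  exists y : 'I_(n p) -> M, forall j, (\prod_(i < p.+1) r i) *: v j = mxact (D p) y j.
Proof.
move=> hr v0.
(* Rung [k] over degree [q] uses the annihilators of degrees [q + 1] to [q + k]; [r 0] is saved for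
   the last step. *)
have lift k q : (q + k <= p)%N -> torsion_lift k q (\prod_(i < k) r (q + i).+1).
  elim: k q => [|k IHk] q le_p; first exact: torsion_lift0.
  rewrite big_ord_recl /= addn0; apply: torsion_liftS; last by apply: hr; lia.
  rewrite (eq_bigr (fun i : 'I_k => r (q.+1 + i).+1)); first by apply: IHk; lia.
  by move=> i _; rewrite /= /bump /= addnCA.
pose zeta j := res_aug I (v j).
have [||g [eta [gZ eta0 zge]]] := @torsion_lift_decomposition p 0 _ zeta (lift p 0%N (leqnn p)).
- by move=> j; exact: res_d_aug.
- move=> i; rewrite -mxact_linear v0 linear0; exact: submodule0.
have /choice[y hy] j : exists y, res_aug I y = eta j by apply/res_exact0.
exists (fun j => r 0%N *: y j) => j; apply: (@res_aug_inj _ _ I).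
rewrite big_ord_recl /= mxactZr -scalerA !linearZ /= mxact_linear (eq_mxact _ _ hy).
(* The coboundaries in degree 0 are zero, so [r 0] kills [g] itself and only the part coming from
   [M] survives. *)
rewrite -[RHS]add0r -(hr 0%N (leq0n _) _ (gZ j)) -scalerDr -zge.
by [].
Qed.

End FreeComplex.

(** * The Koszul complex *)

Section Koszul.
Local Open Scope ring_scope.
Variable R : comNzRingType.

Lemma mxact_scalar (E : lmodType R) a (x : R) (f : 'I_a -> E) i :
  mxact x%:M f i = x *: f i.
Proof.
rewrite /mxact (bigD1 i) //= mxE eqxx big1 ?addr0 // => j /negPf ji.
by rewrite mxE eq_sym ji scale0r.
Qed.

Lemma mxact_colu (E : lmodType R) a1 a2 b (A1 : 'M[R]_(a1, b)) (A2 : 'M[R]_(a2, b))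
    (f : 'I_b -> E) i :
  mxact (col_mx A1 A2) f (lshift a2 i) = mxact A1 f i.
Proof. by apply: eq_bigr => j _; rewrite col_mxEu. Qed.

Lemma mxact_cold (E : lmodType R) a1 a2 b (A1 : 'M[R]_(a1, b)) (A2 : 'M[R]_(a2, b))
    (f : 'I_b -> E) i :
  mxact (col_mx A1 A2) f (rshift a1 i) = mxact A2 f i.
Proof. by apply: eq_bigr => j _; rewrite col_mxEd. Qed.

Lemma mxact_row (E : lmodType R) a b1 b2 (A1 : 'M[R]_(a, b1)) (A2 : 'M[R]_(a, b2))
    (f : 'I_(b1 + b2) -> E) i :
  mxact (row_mx A1 A2) f i =
    mxact A1 (fun j => f (lshift b2 j)) i + mxact A2 (fun j => f (rshift b1 j)) i.
Proof.
rewrite /mxact big_split_ord; congr (_ + _); apply: eq_bigr => j _.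
  by rewrite row_mxEl.
by rewrite row_mxEr.
Qed.

(* The Koszul cochain complex of [s], as an iterated mapping cone; the term of
   cohomological degree [p] has index [p.+1]. *)
Fixpoint koszul_dim (s : seq R) (p : nat) : nat :=
  match s with
  | [::] => (p == 1%N)
  | _ :: s' => match p with
               | 0 => koszul_dim s' 0
               | p'.+1 => koszul_dim s' p'.+1 + koszul_dim s' p'
               end
  end.

Fixpoint koszul_diff (s : seq R) : forall p, 'M[R]_(koszul_dim s p.+1, koszul_dim s p) :=
  match s return forall p, 'M[R]_(koszul_dim s p.+1, koszul_dim s p) with
  | [::] => fun p => 0
  | x :: s' => fun p =>
      match p return 'M[R]_(koszul_dim (x :: s') p.+1, koszul_dim (x :: s') p) with
      | 0 => col_mx (koszul_diff s' 0) x%:M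
      | p'.+1 => block_mx (koszul_diff s' p'.+1) 0 x%:M (- koszul_diff s' p')
      end
  end.

Lemma koszul_dim0 s : koszul_dim s 0 = 0%N.
Proof. by elim: s. Qed.

Lemma koszul_dim_gt s p : ((size s).+1 < p)%N -> koszul_dim s p = 0%N.
Proof.
elim: s p => [|x s IHs] [|p] //=; first by case: p.
by move=> lt_p; rewrite !IHs //; lia.
Qed.

Lemma koszul_ord_gt s p : ((size s).+1 < p)%N -> 'I_(koszul_dim s p) -> False.
Proof. by move=> /koszul_dim_gt -> []. Qed.

Lemma koszul_dim_top s : (0 < koszul_dim s (size s).+1)%N.
Proof. by elim: s => //= x s IHs; rewrite addn_gt0 IHs orbT. Qed.

Lemma koszul_diffK s p : koszul_diff s p.+1 *m koszul_diff s p = 0.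
Proof.
elim: s p => [|x s IHs] p /=; first by rewrite mul0mx.
case: p => [|p].
  rewrite mul_block_col IHs mul0mx addr0 mul_scalar_mx mul_mx_scalar scalerN subrr.
  exact: col_mx0.
rewrite mulmx_block !IHs !mul0mx !mulmx0 !addr0 add0r mul_scalar_mx mul_mx_scalar.
by rewrite scalerN subrr mulNmx mulmxN opprK IHs block_mx0.
Qed.

(** For the head of the list the homotopy is the identity between the two copies in the cone; for
    the tail it acts on both copies, with a sign on the shifted one. *)
Lemma koszul_homotopy s x : x \in s ->
  exists S : forall p, 'M[R]_(koszul_dim s p, koszul_dim s p.+1),
    forall p, S p.+1 *m koszul_diff s p.+1 + koszul_diff s p *m S p = x%:M.
Proof.
elim: s => // y s IHs; rewrite inE => /orP[/eqP <- {y}|/IHs[S hS]].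
  exists (fun p => match p return 'M[R]_(koszul_dim (x :: s) p, koszul_dim (x :: s) p.+1) with
                   | 0 => row_mx 0 1%:M
                   | p'.+1 => block_mx 0 1%:M 0 0
                   end).
  case=> [|p] /=.
    rewrite mulmx_block mul_col_row !mul0mx !mulmx0 !add0r !mul1mx !mulmx1.
    by rewrite add_block_mx !addr0 addNr add0r -scalar_mx_block.
  rewrite !mulmx_block !mul0mx !mulmx0 !add0r !addr0 !mul1mx !mulmx1.
  by rewrite add_block_mx !addr0 addNr add0r -scalar_mx_block.
exists (fun p => match p return 'M[R]_(koszul_dim (y :: s) p, koszul_dim (y :: s) p.+1) with
                 | 0 => row_mx (S 0%N) 0
                 | p'.+1 => block_mx (S p'.+1) 0 0 (- S p')
                 end).
case=> [|p] /=.
  rewrite mulmx_block mul_col_row !mul0mx !mulmx0 !add0r !addr0.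
  rewrite add_block_mx hS addr0 mul_scalar_mx mul_mx_scalar scalerN addNr.
  (* The term of index 0 is zero, so this equation concerns an empty matrix. *)
  rewrite mulNmx mulmxN opprK addr0 (_ : S 0%N *m _ = x%:M) -?scalar_mx_block //.
  by apply/matrixP => -[i lt_i]; exfalso; rewrite koszul_dim0 in lt_i.
rewrite !mulmx_block !mul0mx !mulmx0 !add0r !addr0.
rewrite add_block_mx hS addr0 mul_scalar_mx mul_mx_scalar scalerN addNr.
by rewrite !mulNmx !mulmxN !opprK hS -scalar_mx_block.
Qed.

Lemma ideal_gen_cons (y : R) s z : ideal_gen [set` y :: s] z ->
  exists u, ideal_gen [set` s] (z - u * y).
Proof.
have -> : [set` y :: s] = [set` s] `|` [set y].
  apply/seteqP; split=> w /=; rewrite inE.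
    by case/orP => [/eqP ->|]; [right|left].
  by case=> [->|/eqP->] //; rewrite orbT.
rewrite ideal_genU => -[a sa].
have: ideal_gen [set y] `<=` range (fun u => u * y).
  apply: ideal_gen_sub; last by move=> _ ->; exists 1; rewrite ?mul1r.
  split.
  - by exists 0; rewrite ?mul0r.
  - by move=> _ _ [u _ <-] [v _ <-]; exists (u + v); rewrite ?mulrDl.
  - by move=> e _ [u _ <-]; exists (e * u); rewrite ?mulrA.
by move=> /[apply] -[u _ uy]; exists u; rewrite uy subKr.
Qed.

Lemma ideal_gen_cons_sub (y : R) s : ideal_gen [set` s] `<=` ideal_gen [set` y :: s].
Proof. by apply: ideal_gen_mono => z /= zs; rewrite inE zs orbT. Qed.

(** With [koszul_top_surj] this computes the top cohomology: the last differential hits exactly the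
    tuples with entries in the ideal of [s]. *)
Lemma koszul_top_image s (eta : 'I_(koszul_dim s (size s)) -> R^o) i :
  ideal_gen [set` s] (mxact (koszul_diff s (size s)) eta i).
Proof.
elim: s eta i => [|y s IHs] eta i /=; first by rewrite mxact0; exact: (mem_ideal0 (is_ideal_gen _)).
rewrite -[i]splitK; case: (fintype.split i) => j /=.
  by case: (@koszul_ord_gt s (size s).+2 (leqnn _) j).
rewrite mxact_cold mxact_row mxact_scalar.
rewrite -[X in mxact X _ j]scaleN1r mxactZl.
have hI := is_ideal_gen [set` y :: s].
apply: (mem_idealD hI).
  exact: (mem_idealMr (eta (lshift _ j)) hI (@sub_ideal_gen R [set` y :: s] y (mem_head y s))).
by apply: (mem_idealMl (-1) hI); apply: ideal_gen_cons_sub; exact: IHs.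
Qed.

Lemma koszul_top_surj s (f : 'I_(koszul_dim s (size s).+1) -> R^o) :
  (forall i, ideal_gen [set` s] (f i)) ->
  exists eta, forall i, f i = mxact (koszul_diff s (size s)) eta i.
Proof.
elim: s f => [|y s IHs] f fs.
  exists (fun=> 0) => i; rewrite mxact0.
  have : ideal_gen [set` [::]] `<=` [set 0 : R].
    by apply: ideal_gen_sub => //; exact: is_ideal_set0.
  exact.
have /choice[u hu] i := ideal_gen_cons (fs (rshift _ i)).
have [eta heta] := IHs (fun i => f (rshift _ i) - u i * y) hu.
exists (fun j => match fintype.split j with inl j => u j | inr j => - eta j end) => i /=.
rewrite -[i]splitK; case: (fintype.split i) => j /=.
  by case: (@koszul_ord_gt s (size s).+2 (leqnn _) j).
rewrite mxact_cold mxact_row mxact_scalar (unsplitK (inl _)).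
rewrite (@eq_mxact _ _ _ _ _ _ (fun j => - 1 *: eta j)); last first.
  by move=> k; rewrite (unsplitK (inr _)) scaleN1r.
rewrite -[X in mxact X _ j]scaleN1r mxactZl mxactZr scalerA mulrNN mulr1 scale1r.
by rewrite -heta [y *: _]mulrC addrC subrK.
Qed.

Lemma koszul_diff_lshift y s p (eta : 'I_(koszul_dim (y :: s) p) -> R^o) j :
  exists eta', mxact (koszul_diff (y :: s) p) eta (lshift _ j) =
    mxact (koszul_diff s p) eta' j.
Proof.
case: p => [|p] in eta j *; first by exists eta; rewrite /= mxact_colu.
by exists (fun j => eta (lshift _ j)); rewrite /= mxact_colu mxact_row mxact0 addr0.
Qed.

(** If the last differential of [s] takes [b] to [z * y], then [(z, b)] is a cocycle of the Koszul
    complex of [y :: s], one degree below the top. Once a multiple of it is a coboundary, the first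
    component lies in the ideal of [s]. *)
Lemma prod_ann_lc_colon (m : set R) (r : nat -> R) (y : R) (s : seq R) z :
  noetherian R -> m = radical (ideal_gen [set` y :: s]) ->
  (forall q, (q <= size s)%N -> ann_lc m R^o q (r q)) ->
  ideal_gen [set` s] (z * y) ->
  ideal_gen [set` s] (\prod_(i < (size s).+1) r i * z).
Proof.
move=> noethR Dm hr zy.
have [I _] := hr 0%N isT.
have [|b hb] := @koszul_top_surj s (fun=> z * y) => //.
pose v (j : 'I_(koszul_dim (y :: s) (size s).+1)) : R^o :=
  match fintype.split j with inl _ => z | inr j => b j end.
have [|||x hx] := @prod_ann_lc_cohomology _ m [set` y :: s] noethR Dm _
  (koszul_diff (y :: s)) (koszul_dim0 _) (koszul_diffK _) _ _ I r (size s) v.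
- move=> x p /koszul_homotopy[S hS]; exists (S p.+1), (S p); exact: hS.
- by move=> q le_q; apply: ann_lc_any_resolution; exact: hr.
- move=> i /=; rewrite -[i]splitK; case: (fintype.split i) => j /=.
    by case: (@koszul_ord_gt s (size s).+2 (leqnn _) j).
  rewrite mxact_cold mxact_row mxact_scalar /v (unsplitK (inl _)).
  rewrite (@eq_mxact _ _ _ _ _ _ b); last by move=> k; rewrite (unsplitK (inr _)).
  by rewrite -[X in mxact X _ j]scaleN1r mxactZl -hb scaleN1r [y *: _]mulrC subrr.
have j : 'I_(koszul_dim s (size s).+1) := Ordinal (koszul_dim_top s).
have := hx (lshift _ j); rewrite /v (unsplitK (inl _)).
have [eta ->] := koszul_diff_lshift x j => E.
rewrite (_ : _ * z = mxact (koszul_diff s (size s)) eta j); last exact: E.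
exact: koszul_top_image.
Qed.

End Koszul.

(** * Systems of parameters *)

Section SystemsOfParameters.
Local Open Scope ring_scope.
Variables (R : comNzRingType) (m : set R).

(** Otherwise [J : c] would lie in a maximal ideal, which is [m], and [m] would contain both [mu]
    and [1 - mu]. *)
Lemma local_cancel (J : set R) mu c : local_ring m -> is_ideal J -> m mu ->
  J ((1 - mu) * c) -> J c.
Proof.
move=> [[hm m1 _] uniq_m] hJ m_mu Jc; apply: contrapT => nJc.
have hC := is_ideal_colon c hJ.
have [|W [hW CW W1 maxW]] := @maximal_submodule_avoiding R R^o (colon J c) [set 1] hC.
  by move=> u Cu u1; apply: nJc; rewrite -[c]mul1r -u1.
have W_m : W = m.
  apply: uniq_m; split=> // [/W1|J' hJ' J'1 WJ']; first exact.
  apply/seteqP; split=> //; apply: maxW => // w J'w w1.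
  by apply: J'1; rewrite -w1.
apply: m1; rewrite -(subrK mu 1); apply: mem_idealD => //.
by rewrite -W_m; apply: CW.
Qed.

(** [torsion_cotrivial_submodule] for [J + m c] inside [J + R c] gives a [W] that contains [c]; so
    [c] lies in [J + m c], and [local_cancel] concludes. *)
Lemma krull_intersection (J : set R) (Y : seq R) c : noetherian R ->
  local_ring m -> is_ideal J -> [set` Y] `<=` m ->
  (forall t, (0 < t)%N ->
     ideal_add J (ideal_gen [set y ^+ t | y in [set` Y]]) c) -> J c.
Proof.
move=> noethR hloc hJ Ym hc.
have hm : is_ideal m by case: hloc => -[].
have hsub K : is_ideal K -> @is_submodule R R^o [set z | exists2 a, K a & J (z - a * c)].
  move=> hK; split.
  - by exists 0; [exact: mem_ideal0 | rewrite mul0r subr0; exact: mem_ideal0].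
  - move=> u v [a Ka Ju] [b Kb Jv]; exists (a + b); first exact: mem_idealD.
    by rewrite mulrDl opprD addrACA; exact: mem_idealD.
  - move=> e u [a Ka Ju]; exists (e * a); first exact: mem_idealMl.
    by rewrite -mulrA -mulrBr; exact: mem_idealMl.
have [|W [hW Z0W WZ Wcot]] :=
    @torsion_cotrivial_submodule R noethR R^o _ _ m (hsub _ (is_idealT R)) (hsub _ hm).
  move=> x z mx [a _ Ja]; exists 1%N, (x * a); first exact: mem_idealMr.
  by rewrite expr1 -mulrA -mulrBr; exact: mem_idealMl.
have [t t0 Yt] : exists2 t, (0 < t)%N & forall y, y \in Y -> W (y ^+ t).
  elim: Y Ym {hc} => [|y Y IHY] Ym; first by exists 1%N.
  have [|t t0 Yt] := IHY; first by move=> z zY; apply: Ym; rewrite /= inE zY orbT.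
  have [|k] := Wcot y 1; first by apply: Ym; rewrite /= inE eqxx.
  rewrite [_ *: _]mulr1 => Wk; exists (k + t)%N; first by rewrite addn_gt0 t0 orbT.
  move=> z; rewrite inE => /orP[/eqP->|/Yt Wz]; last by rewrite exprD; exact: (submoduleZ _ hW).
  by rewrite addnC exprD; exact: (submoduleZ _ hW).
have Wc : W c.
  have := hc t t0; apply: ideal_add_sub => //.
    move=> a Ja; apply: Z0W; exists 0; first exact: mem_ideal0.
    by rewrite mul0r subr0.
  by apply: ideal_gen_sub => // _ [y Yy <-]; exact: Yt.
have [|mu m_mu Jc] := WZ _ Wc; first by exists 1 => //; rewrite mul1r subrr; exact: mem_ideal0.
by apply: (local_cancel hloc hJ m_mu); rewrite mulrBl mul1r.
Qed.

Lemma ideal_prod_sub d (I : nat -> set R) (K : set R) : is_ideal K ->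
  (forall r : nat -> R, (forall i, (i < d)%N -> I i (r i)) -> K (\prod_(i < d) r i)) ->
  ideal_prod d I `<=` K.
Proof.
elim: d I K => [|d IHd] I K hK hI; rewrite /ideal_prod.
  rewrite big_ord0 => a _; rewrite -[a]mulr1; apply: mem_idealMl => //.
  by have := hI (fun=> 0); rewrite big_ord0; apply.
rewrite big_ord_recl; apply: ideal_mul_sub => // a b Ia.
rewrite -[_ (a * b)]/(colon K b a) => Ib.
suff : colon K a b by rewrite /colon /= mulrC.
move: b Ib; apply: (IHd (fun i => I i.+1)); first exact: is_ideal_colon.
move=> r hr; rewrite /colon /= mulrC.
have := hI (fun i => if i is i'.+1 then r i' else a).
rewrite big_ord_recl /=; apply=> -[|i] //; exact: hr.
Qed.

Lemma is_ideal_prod d (I : nat -> set R) : is_ideal (ideal_prod d I).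
Proof.
by case: d => [|d]; rewrite /ideal_prod ?big_ord0 ?big_ord_recl;
  [exact: is_idealT | exact: is_ideal_mul].
Qed.

Lemma ideal_a_colon d (x : 'I_d -> R) alpha B i l z a : noetherian R ->
  local_ring m -> sop m x -> (forall j, (0 < alpha j)%N) ->
  ~ B i -> (0 < l)%N -> gen_powers x alpha B (z * x i ^+ l) -> ideal_a m d a ->
  gen_powers x alpha B (a * z).
Proof.
move=> noethR hloc hx a0 nBi l0 hz ha.
have hm : is_ideal m by case: hloc => -[].
have hG : is_ideal (gen_powers x alpha B) by exact: is_ideal_gen_powers.
have xm j : m (x j).
  by rewrite -hx; apply: sub_radical; apply: sub_ideal_gen; exists j.
suff: ideal_a m d `<=` colon (gen_powers x alpha B) z by apply.
apply: ideal_prod_sub; first exact: is_ideal_colon.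
move=> r hr; rewrite /colon /=.
pose js := enum [pred j : 'I_d | j != i].
have mem_js j : (j \in js) = (j != i) by rewrite mem_enum.
pose Y := [seq x j | j <- js & ~~ `[< B j >]].
apply: (@krull_intersection _ Y) => // [_ /mapP[j _ ->] //|t t0].
pose e j := if `[< B j >] then alpha j else t.
pose s := [seq x j ^+ e j | j <- js].
have e0 j : (0 < e j)%N by rewrite /e; case: ifP.
(* With [x i ^+ l] the family has [d] members, so the annihilators used are those of degrees 0 to
   [d - 1], the factors of [ideal_a]. *)
have hs : (size s).+1 = d.
  rewrite size_map -cardE (eq_card (B := predC1 i)) // cardC1 card_ord prednK //.
  by case: (i) => k; case: (d).
have : ideal_gen [set` s] (\prod_(k < (size s).+1) r k * z).
  apply: (@prod_ann_lc_colon _ m r (x i ^+ l)) => //.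
  (* Replacing parameters by positive powers does not change the radical. *)
  - have hrad := is_ideal_radical (is_ideal_gen [set` x i ^+ l :: s]).
    have xrad j : radical (ideal_gen [set` x i ^+ l :: s]) (x j).
      have [->|ji] := eqVneq j i.
        by exists l; apply: sub_ideal_gen; rewrite /= inE eqxx.
      exists (e j); apply: sub_ideal_gen; rewrite /= inE; apply/orP; right.
      by apply: map_f; rewrite mem_js.
    apply/seteqP; split=> u.
      rewrite -[in X in X -> _]hx => -[k uk].
      have : radical (ideal_gen [set` x i ^+ l :: s]) (u ^+ k).
        by have := uk; apply: ideal_gen_sub => // _ [j _ <-].
      by case=> k'; rewrite -exprM; exists (k * k')%N.
    case=> k uk.
    have : m (u ^+ k).
      have := uk; apply: ideal_gen_sub => // y; rewrite /= inE.
      have mX j n : (0 < n)%N -> m (x j ^+ n).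
        by case: n => // n _; rewrite exprS; exact: mem_idealMr.
      by case/orP => [/eqP->|/mapP[j _ ->]]; exact: mX.
    by rewrite -hx => -[k']; rewrite -exprM; exists (k * k')%N.
  - by move=> q; rewrite -ltnS hs; exact: hr.
  have := hz; apply: ideal_gen_sub => // _ [j Bj <-]; apply: sub_ideal_gen.
  rewrite /= (_ : alpha j = e j); last by rewrite /e asboolT.
  by apply: (map_f (fun j => x j ^+ e j)); rewrite mem_js; apply/eqP => ji; case: nBi; rewrite -ji.
rewrite hs; apply: ideal_gen_sub; first exact: is_ideal_add.
move=> _ /mapP[j j_js ->]; rewrite /e; case: asboolP => Bj.
  by apply: ideal_addl => //; apply: sub_ideal_gen; exists j.
apply: ideal_addr => //; apply: sub_ideal_gen; exists (x j) => //=.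
by apply: map_f; rewrite mem_filter j_js andbT; apply/asboolPn.
Qed.

End SystemsOfParameters.

Theorem mainTheorem1 (R : comNzRingType) (m : set R) (d : nat)
    (hnoeth : noetherian R) (hlocal : local_ring m) (hdim : krull_dim R d)
    (hd : (1 <= d)%N) :
  ((d = 1%N -> ideal_a m d `<=` ideal_c m d) /\
   ((2 <= d)%N -> ideal_pow (ideal_a m d) (2 ^ (d - 2)) `<=` ideal_c m d)) /\
  ideal_pow (ideal_a m d) (2 ^ (d - 1)) `<=` ideal_d m d.
Proof.
have hA : is_ideal (ideal_a m d) by exact: is_ideal_prod.
have hC x (hx : sop m x) := fun alpha B i l z a =>
  @ideal_a_colon R m d x alpha B i l z a hnoeth hlocal hx.
split; first split.
- move=> d1 r Ar x hx s n n0.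
  apply: (ideal_pow_ann_colon hA (hC x hx)) => //.
  (* Here [s = 0], and the truncated exponent gives [2 ^ 0 = 1]. *)
  rewrite (_ : 2 ^ s.-1 = 1)%N ?ideal_pow1 //.
  by move: (ltn_ord s); rewrite [X in (_ < X)%N]d1; case: (nat_of_ord s).
- move=> d2 r Ar x hx s n n0.
  apply: (ideal_pow_ann_colon hA (hC x hx)) => //.
  apply: ideal_pow_le Ar; rewrite leq_exp2l //; move: (ltn_ord s); lia.
- move=> r Ar x hx s hs n s0 n0.
  apply: (ideal_pow_ann_intersection hA (hC x hx)) => //.
  apply: ideal_pow_le Ar; rewrite /kernel_exponent.
  (* [2 ^ (s - 1) - 1] is at most [2 ^ (d - 1)] since [s <= d]. *)
  apply: leq_trans (leq_pred _) _; rewrite leq_exp2l //; lia.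
Qed.
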